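(* Let $H\le F_n$ be a finitely generated subgroup, let $g\in F_n$, $g\neq 1$, be an element that depends on $H$, and let $d\ge1$ be an integer. Let $G=\mathrm{core}_*(H)\vee\mathrm{core}_*(\langle g\rangle)$ and let $L$ be the number of edges of $G$. Suppose $\mathfrak I_g$ contains a non-trivial equation of degree $d$. Then $\mathfrak I_g$ contains a non-trivial equation $w$ of degree $d$ such that the corresponding path $\sigma:I_l\to G$ has length $l\le 32L^4d^2+16L^3d$.
   Context: Equations. $F_n$ is the free group with basis $a_1,\dots,a_n$, and $\langle x\rangle\cong\mathbb Z$. An equation is an element $w\in H*\langle x\rangle$, uniquely expressed as a reduced word in the alphabet $\{x,x^{-1}\}\cup(H\setminus\{1\})$; its degree is the number of occurrences of $x$ and $x^{-1}$ in its cyclic reduction. $\varphi_g:H*\langle x\rangle\to F_n$ is the inclusion on $H$ and sends $x$ to $g$; $\mathfrak I_g=\ker\varphi_g$. $g$ depends on $H$ if $\mathfrak I_g\neq1$. Graphs and paths. A graph is a 1-dimensional CW complex (loops and multiple edges allowed). A combinatorial map of graphs is a continuous map sending vertices to vertices and each open edge homeomorphically onto an open edge. $I_l$ ($l\ge1$) is the unit interval subdivided into $l$ edges, with vertices $i/l$. A combinatorial path of length $l$ in a graph is a combinatorial map from $I_l$; it is reduced if it is locally injective. Core graphs. $R_n$ is the rose with one vertex and $n$ oriented edges labeled $a_1,\dots,a_n$, with $\pi_1(R_n,* )=F_n$. For $K\le F_n$, $(\mathrm{cov}(K),* )\to(R_n,* )$ is the pointed covering with fundamental group $K$; for $K\ne1$,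 $\mathrm{core}_*(K)$ is the subgraph of $\mathrm{cov}(K)$ given by the union of the images of all reduced paths from the basepoint $*$ to itself. It is labeled by restricting the covering map, and $\pi_1(\mathrm{core}_*(K),* )\cong K$. The graph $G$ is obtained from the disjoint union of $\mathrm{core}_*(H)$ and $\mathrm{core}_*(\langle g\rangle)$ by identifying the basepoints to a point $*$. Let $\theta:H*\langle x\rangle\to\pi_1(G,* )$ be the isomorphism sending each element of $H$ to the corresponding class in $\mathrm{core}_*(H)$ and $x$ to the class in $\mathrm{core}_*(\langle g\rangle)$ corresponding to $g$. The path corresponding to a non-trivial equation $w$ is the unique reduced path $\sigma:I_l\to G$, $\sigma(0)=\sigma(1)=*$, in the homotopy class $\theta(w)$ (relative to endpoints). *)

(* Defs.v *)
From HB Require Import structures.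
From mathcomp Require Import all_boot.
From mathcomp Require Import boolp classical_sets functions cardinality.

Set Implicit Arguments.
Unset Strict Implicit.
Unset Printing Implicit Defensive.

Local Open Scope classical_set_scope.
Local Open Scope card_scope.
Local Open Scope group_scope.

(* x ^ (+1) for b = false and x ^ (-1) for b = true. *)
Definition sgnpow (A : groupType) (b : bool) (x : A) : A :=
  if b then x^-1 else x.

Section FreeGroup.
Variable n : nat.

(* (i, false) stands for a_i and (i, true) for its inverse. *)
Local Notation L := ('I_n * bool)%type.

Definition fg_linv (l : L) : L := (l.1, ~~ l.2).

Definition fg_compat : rel L := fun l m => m != fg_linv l.

Definition fg_reduced (w : seq L) : bool := sorted fg_compat w.

(* An element of the free group is its unique reduced word. *)
Record freeGroup := FreeGroup { fgword :> seq L; _ : fg_reduced fgword }.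

HB.instance Definition _ := [isSub of freeGroup for fgword].
HB.instance Definition _ := [Choice of freeGroup by <:].

(* Reduced form of l :: w, for w reduced. *)
Definition fg_act (l : L) (w : seq L) : seq L :=
  if w is m :: w' then (if m == fg_linv l then w' else l :: w) else [:: l].

Definition fg_mulw (u v : seq L) : seq L := foldr fg_act v u.
Definition fg_invw (u : seq L) : seq L := rev (map fg_linv u).

Lemma fg_linvK : involutive fg_linv.
Proof. by case=> i b; rewrite /fg_linv /= negbK. Qed.

Lemma fg_act_reduced l w : fg_reduced w -> fg_reduced (fg_act l w).
Proof.
case: w => [|m w] //= rw; case: eqP => [_|/eqP Nm]; first exact: path_sorted rw.
by rewrite /fg_reduced /= rw andbT /fg_compat.
Qed.

Lemma fg_act_cons l w : fg_reduced (l :: w) -> fg_act l w = l :: w.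
Proof. by case: w => [|m w] //= /andP[]; rewrite /fg_compat => /negbTE->. Qed.

Lemma fg_actK l w : fg_reduced w -> fg_act l (fg_act (fg_linv l) w) = w.
Proof.
case: w => [|m w] /= rw; first by rewrite eqxx.
rewrite fg_linvK; case: eqP => [<-|_] /=; last by rewrite eqxx.
exact: fg_act_cons.
Qed.

Lemma fg_mulw_reduced u v : fg_reduced v -> fg_reduced (fg_mulw u v).
Proof. by move=> rv; elim: u => //= l u; apply: fg_act_reduced. Qed.

Lemma fg_mulw_act l u v :
  fg_reduced v -> fg_mulw (fg_act l u) v = fg_act l (fg_mulw u v).
Proof.
move=> rv; case: u => [|m u] //=; case: eqP => [->|//].
by rewrite fg_actK // fg_mulw_reduced.
Qed.

Lemma fg_mulwA u v w : fg_reduced w ->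
  fg_mulw u (fg_mulw v w) = fg_mulw (fg_mulw u v) w.
Proof. by move=> rw; elim: u => //= l u ->; rewrite fg_mulw_act. Qed.

Lemma fg_mulw1 u : fg_reduced u -> fg_mulw u [::] = u.
Proof.
elim: u => //= l u IHu ru; rewrite IHu; last exact: path_sorted ru.
exact: fg_act_cons.
Qed.

Lemma fg_mulVw u w : fg_reduced w -> fg_mulw (fg_invw u) (fg_mulw u w) = w.
Proof.
move=> rw; rewrite /fg_invw; elim: u => //= l u IHu.
rewrite rev_cons /fg_mulw -cats1 foldr_cat /= -/(fg_mulw u w).
by rewrite -{2}(fg_linvK l) fg_actK ?IHu ?fg_mulw_reduced.
Qed.

Lemma fg_invwK u : fg_invw (fg_invw u) = u.
Proof. by rewrite /fg_invw map_rev revK (mapK fg_linvK). Qed.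

Lemma fg_invw_reduced u : fg_reduced u -> fg_reduced (fg_invw u).
Proof.
move=> ru; rewrite /fg_reduced /fg_invw rev_sorted sorted_map.
apply: sub_sorted ru => l m /=.
by rewrite /fg_compat fg_linvK eq_sym.
Qed.

Fact fg_one_subproof : fg_reduced [::]. Proof. by []. Qed.
Fact fg_mul_subproof (u v : freeGroup) : fg_reduced (fg_mulw u v).
Proof. exact/fg_mulw_reduced/valP. Qed.
Fact fg_inv_subproof (u : freeGroup) : fg_reduced (fg_invw u).
Proof. exact/fg_invw_reduced/valP. Qed.

Definition fg_one := FreeGroup fg_one_subproof.
Definition fg_mul u v := FreeGroup (fg_mul_subproof u v).
Definition fg_inv u := FreeGroup (fg_inv_subproof u).

Fact fg_mulA : associative fg_mul.
Proof. by move=> u v w; apply/val_inj/fg_mulwA/valP. Qed.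
Fact fg_mul1 : left_id fg_one fg_mul.
Proof. by move=> u; apply/val_inj. Qed.
Fact fg_1mul : right_id fg_one fg_mul.
Proof. by move=> u; apply/val_inj/fg_mulw1/valP. Qed.
Fact fg_mulV : left_inverse fg_one fg_inv fg_mul.
Proof.
move=> u; apply/val_inj => /=.
by rewrite -{2}(fg_mulw1 (valP u)) fg_mulVw.
Qed.
Fact fg_Vmul : right_inverse fg_one fg_inv fg_mul.
Proof.
move=> u; apply/val_inj => /=; rewrite -{1}(fg_invwK u).
by rewrite -{2}(fg_mulw1 (fg_invw_reduced (valP u))) fg_mulVw.
Qed.

HB.instance Definition _ :=
  isGroup.Build freeGroup fg_mulA fg_mul1 fg_1mul fg_mulV fg_Vmul.

Definition fgen (i : 'I_n) : freeGroup := @FreeGroup [:: (i, false)] isT.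

End FreeGroup.

Definition is_subgroup (A : groupType) (K : set A) : Prop :=
  group_closed (mem K).

Definition gen_by (A : groupType) (S : set A) : set A :=
  smallest (@is_subgroup A) S.

Definition finitely_generated (A : groupType) (K : set A) : Prop :=
  exists s : seq A, K = gen_by [set` s].

Section Equations.
Variable A : groupType.

(* inl h is the coefficient h; inr false is x and inr true is x^-1. *)
Local Notation L := (A + bool)%type.

Definition eq_proper : pred L := fun l => if l is inl h then h != 1 else true.

Definition eq_compat : rel L := fun l m =>
  match l, m with
  | inl _, inl _ => false
  | inr b, inr c => b == c
  | _, _ => true
  end.

Definition eq_reduced (w : seq L) : bool :=
  all eq_proper w && sorted eq_compat w.
Arguments eq_reduced : simpl never.

(* The free product A * <x>: an element is its unique reduced word. *)
Record equation := Equation { eqword :> seq L; _ : eq_reduced eqword }.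

HB.instance Definition _ := [isSub of equation for eqword].
HB.instance Definition _ := [Choice of equation by <:].

(* Reduced form of l :: w, for w reduced; l may be the improper letter inl 1. *)
Definition eq_act (l : L) (w : seq L) : seq L :=
  match l, w with
  | inl h, inl k :: w' => if h * k == 1 then w' else inl (h * k) :: w'
  | inl h, _ => if h == 1 then w else l :: w
  | inr b, inr c :: w' => if b == c then l :: w else w'
  | inr _, _ => l :: w
  end.

Definition eq_linv (l : L) : L :=
  match l with inl h => inl h^-1 | inr b => inr (~~ b) end.

Definition eq_mulw (u v : seq L) : seq L := foldr eq_act v u.
Definition eq_invw (u : seq L) : seq L := rev (map eq_linv u).

Lemma eq_linvK : involutive eq_linv.
Proof. by case=> [h|b] /=; rewrite ?invgK ?negbK. Qed.

Lemma eq_reduced_cons l w : eq_reduced (l :: w) =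
  [&& eq_proper l, (if w is m :: _ then eq_compat l m else true)
    & eq_reduced w].
Proof.
rewrite /eq_reduced /=; case: w => [|m w] /=; first by rewrite !andbT.
by case: (eq_proper l) => //=; case: (eq_compat l m); rewrite /= ?andbF.
Qed.

Lemma eq_act_reduced l w : eq_reduced w -> eq_reduced (eq_act l w).
Proof.
case: w => [|m w]; case: l => [h|b]; rewrite ?eq_reduced_cons //=.
- by case: ifPn => // h1; rewrite eq_reduced_cons /= h1.
- case: m => [k|c] /and3P[pk cw rw] /=.
    case: ifPn => // h1; rewrite eq_reduced_cons /= h1 rw andbT.
    by case: w cw {rw} => [|[]].
  by case: ifPn => h1; rewrite !eq_reduced_cons /= cw rw ?h1.
case: m => [k|c] /and3P[pk cw rw] /=.
  by rewrite !eq_reduced_cons pk cw rw.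
by case: ifPn => // bc; rewrite !eq_reduced_cons /= bc cw rw.
Qed.

Lemma eq_act_cons l w : eq_reduced (l :: w) -> eq_act l w = l :: w.
Proof.
rewrite eq_reduced_cons; case: l => [h|b]; case: w => [|[k|c] w] //=.
- by rewrite andbT => /negbTE->.
- by rewrite andbF.
- by case/and3P => /negbTE->.
- by case/andP => ->.
Qed.

Lemma eq_act1 w : eq_reduced w -> eq_act (inl 1) w = w.
Proof.
case: w => [|[k|c] w] //=; rewrite ?eqxx // eq_reduced_cons mul1g /=.
by case/and3P => /negbTE->.
Qed.

Lemma eq_actM h k w : eq_reduced w ->
  eq_act (inl h) (eq_act (inl k) w) = eq_act (inl (h * k)) w.
Proof.
have simple v : eq_reduced v -> (if v is inl _ :: _ then false else true) ->
    eq_act (inl h) (eq_act (inl k) v) = eq_act (inl (h * k)) v.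
  move=> rv hv; have E j : eq_act (inl j) v = if j == 1 then v else inl j :: v.
    by case: v hv {rv} => [|[]].
  rewrite !E; case: (eqVneq k 1) => [->|k1]; first by rewrite mulg1 E.
  by [].
case: w => [|[j|c] w]; [by move=> r; apply: simple| |by move=> r; apply: simple].
rewrite eq_reduced_cons => /and3P[pj cw rw] /=; rewrite -mulgA.
have hw : if w is inl _ :: _ then false else true by case: w cw {rw} => [|[]].
case: (eqVneq (k * j) 1) => [->|_] //=.
rewrite mulg1; case: w hw {cw rw} => [|[]] //.
Qed.

Lemma eq_actK l w : eq_reduced w -> eq_act l (eq_act (eq_linv l) w) = w.
Proof.
case: l => [h|b] rw; first by rewrite eq_actM // mulgV eq_act1.
case: w rw => [|[k|c] w]; case: b => //; case: c => //.
- exact: (@eq_act_cons (inr true)).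
- exact: (@eq_act_cons (inr false)).
Qed.

Lemma eq_mulw_reduced u v : eq_reduced v -> eq_reduced (eq_mulw u v).
Proof. by move=> rv; elim: u => //= l u; apply: eq_act_reduced. Qed.

Lemma eq_mulw_act l u v :
  eq_reduced v -> eq_mulw (eq_act l u) v = eq_act l (eq_mulw u v).
Proof.
move=> rv; have r w : eq_reduced (eq_mulw w v) by exact: eq_mulw_reduced.
have Mc m w : eq_mulw (m :: w) v = eq_act m (eq_mulw w v) by [].
move: (eq_mulw^~ v) r Mc => M r Mc.
case: l u => [h|b] [|[k|c] u]; rewrite [in LHS]/= ?Mc //.
- by case: eqP => [->|]; rewrite ?eq_act1 ?Mc.
- by rewrite eq_actM //; case: eqP => [->|]; rewrite ?eq_act1 ?Mc.
- by case: eqP => [->|]; rewrite -Mc ?eq_act1 ?Mc // -?Mc.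
case: (eqVneq b c) => [_|bc]; first by rewrite !Mc.
have {bc} -> : c = ~~ b by case: b c bc => [] [].
by rewrite (@eq_actK (inr b)).
Qed.

Lemma eq_mulwA u v w : eq_reduced w ->
  eq_mulw u (eq_mulw v w) = eq_mulw (eq_mulw u v) w.
Proof. by move=> rw; elim: u => //= l u ->; rewrite eq_mulw_act. Qed.

Lemma eq_mulw1 u : eq_reduced u -> eq_mulw u [::] = u.
Proof.
elim: u => //= l u IHu ru; rewrite IHu ?eq_act_cons //.
by move: ru; rewrite eq_reduced_cons => /and3P[].
Qed.

Lemma eq_mulVw u w : eq_reduced w -> eq_mulw (eq_invw u) (eq_mulw u w) = w.
Proof.
move=> rw; rewrite /eq_invw; elim: u => //= l u IHu.
rewrite rev_cons /eq_mulw -cats1 foldr_cat /= -/(eq_mulw u w).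
by rewrite -{2}(eq_linvK l) eq_actK ?IHu ?eq_mulw_reduced.
Qed.

Lemma eq_invwK u : eq_invw (eq_invw u) = u.
Proof. by rewrite /eq_invw map_rev revK (mapK eq_linvK). Qed.

Lemma eq_invw_reduced u : eq_reduced u -> eq_reduced (eq_invw u).
Proof.
case/andP => pu su; rewrite /eq_reduced /eq_invw all_rev rev_sorted.
rewrite all_map sorted_map; apply/andP; split.
  by apply: sub_all pu => -[h|] //=; rewrite -{2}invg1 (inj_eq invg_inj).
by apply: sub_sorted su => -[h|b] [k|c] //= /eqP->.
Qed.

Fact eq_one_subproof : eq_reduced [::]. Proof. by []. Qed.
Fact eq_mul_subproof (u v : equation) : eq_reduced (eq_mulw u v).
Proof. exact/eq_mulw_reduced/valP. Qed.
Fact eq_inv_subproof (u : equation) : eq_reduced (eq_invw u).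
Proof. exact/eq_invw_reduced/valP. Qed.

Definition eq_one := Equation eq_one_subproof.
Definition eq_mul u v := Equation (eq_mul_subproof u v).
Definition eq_inv u := Equation (eq_inv_subproof u).

Fact eq_mulA : associative eq_mul.
Proof. by move=> u v w; apply/val_inj/eq_mulwA/valP. Qed.
Fact eq_mul1 : left_id eq_one eq_mul.
Proof. by move=> u; apply/val_inj. Qed.
Fact eq_1mul : right_id eq_one eq_mul.
Proof. by move=> u; apply/val_inj/eq_mulw1/valP. Qed.
Fact eq_mulV : left_inverse eq_one eq_inv eq_mul.
Proof.
move=> u; apply/val_inj => /=.
by rewrite -{2}(eq_mulw1 (valP u)) eq_mulVw.
Qed.
Fact eq_Vmul : right_inverse eq_one eq_inv eq_mul.
Proof.
move=> u; apply/val_inj => /=; rewrite -{1}(eq_invwK u).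
by rewrite -{2}(eq_mulw1 (eq_invw_reduced (valP u))) eq_mulVw.
Qed.

HB.instance Definition _ :=
  isGroup.Build equation eq_mulA eq_mul1 eq_1mul eq_mulV eq_Vmul.

(* A one-letter word counts as cyclically reduced. *)
Definition cyclically_reduced (w : seq L) : bool :=
  (size w <= 1) || cycle eq_compat w.

(* Conjugation by the last letter, which shortens w unless w is cyclically
   reduced. *)
Definition cyclic_step (w : seq L) : seq L :=
  if cyclically_reduced w then w
  else if w is l :: w' then eq_act (last l w') (belast l w') else w.

Definition cyclic_reduction (w : seq L) : seq L :=
  iter (size w) cyclic_step w.

Definition is_x : pred L := fun l => if l is inr _ then true else false.

Definition degree (w : equation) : nat := count is_x (cyclic_reduction w).

Lemma cyclic_step_conj (w : equation) :
  exists u v : equation, eqword v = cyclic_step w /\ w = u * v * u^-1.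
Proof.
rewrite /cyclic_step; case: ifP => _.
  by exists 1, w; rewrite mul1g invg1 mulg1.
case: w => -[|l w] rw /=.
  by exists 1, (Equation rw); rewrite mul1g invg1 mulg1.
set m := last l w; set s := belast l w.
have Ew : l :: w = rcons s m by exact: lastI.
have /andP[/andP[pm ps] ss] : eq_proper m && all eq_proper s && sorted eq_compat s.
  move: (rw); rewrite Ew /eq_reduced all_rcons -cats1 => /andP[-> /=].
  by case: (s) => //= y r; rewrite cat_path => /andP[].
have rm : eq_reduced [:: m] by rewrite /eq_reduced /= pm.
have rs : eq_reduced s by rewrite /eq_reduced ps ss.
exists (Equation rm)^-1, (Equation (eq_act_reduced m rs)); split=> //.
suff -> : Equation (eq_act_reduced m rs) = Equation rm * Equation rw / Equation rm.
  by rewrite invgK -!mulgA mulKg mulVg mulg1.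
apply/val_inj; rewrite -mulgA.
change (eq_act m s = eq_act m (eq_mulw (l :: w) (eq_invw [:: m]))); rewrite Ew.
rewrite /eq_mulw -cats1 foldr_cat.
have -> : foldr eq_act (eq_invw [:: m]) [:: m] = [::].
  rewrite -[RHS](@eq_actK m [::]) //=; congr eq_act.
  by case: (m) pm => //= h; rewrite -(inj_eq invg_inj) invg1 => /negbTE->.
by rewrite -/(eq_mulw s [::]) eq_mulw1.
Qed.

Lemma size_cyclic_step (w : equation) :
  ~~ cyclically_reduced w -> size (cyclic_step w) < size w.
Proof.
rewrite /cyclic_step => Nw; rewrite (negbTE Nw).
case: w Nw => -[|l [|m w]] //=; rewrite /cyclically_reduced /=.
move=> /andP[_ /= /andP[lm pw]]; rewrite rcons_path lm pw /=.
by case: (last m w) l {lm} => [h|b] [k|c] //=; case: ifP; rewrite /= ?size_belast.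
Qed.

Lemma cyclic_reductionP (w : equation) : exists u v : equation,
  [/\ eqword v = cyclic_reduction w, cyclically_reduced v & w = u * v * u^-1].
Proof.
rewrite /cyclic_reduction; move: (leqnn (size w)); move: {2 3}(size w) => k.
elim: k w => [|k IHk] w sw.
  exists 1, w; rewrite mul1g invg1 mulg1; split=> //.
  by rewrite /cyclically_reduced (leq_trans sw).
have [u [v [Ev Ew]]] := cyclic_step_conj w.
rewrite iterSr -Ev; case: (boolP (cyclically_reduced w)) => cw.
  exists 1, w; rewrite mul1g invg1 mulg1; split=> //.
  have fix_w : cyclic_step w = w by rewrite /cyclic_step cw.
  by rewrite Ev fix_w; elim: (k) => //= j <-; rewrite fix_w.
have [|u' [v' [Ev' cv' Ew']]] := IHk v.
  by rewrite Ev -ltnS (leq_trans (size_cyclic_step cw)).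
by exists (u * u'), v'; split=> //; rewrite Ew Ew' invgM !mulgA.
Qed.

End Equations.

Section Ideal.
Variable A : groupType.

(* H * <x>, as the subgroup of A * <x> of the words with coefficients in H. *)
Definition coeffs_in (H : set A) : set (equation A) :=
  [set w | forall h : A, inl h \in eqword w -> H h].

Definition letter_value (g : A) (l : A + bool) : A :=
  match l with inl h => h | inr b => sgnpow b g end.

(* The homomorphism that is the identity on A and sends x to g. *)
Definition phi (g : A) (w : equation A) : A :=
  \prod_(l <- eqword w) letter_value g l.

Lemma phiM g : {morph phi g : u v / u * v}.
Proof.
move=> u v; rewrite /phi -[eqword (u * v)]/(eq_mulw u v).
elim: (eqword u) => [|l s IHs].
  by rewrite big_nil mul1g.
rewrite -[eq_mulw _ _]/(eq_act l (eq_mulw s v)) big_cons -mulgA -IHs.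
move: (eq_mulw s v) => {IHs} t.
have inl_act h r : \prod_(m <- eq_act (inl h) r) letter_value g m =
    h * \prod_(m <- r) letter_value g m.
  case: r => [|[k|c] r] /=; rewrite ?big_cons ?big_nil /=.
  - by case: eqP => [->|_]; rewrite ?big_cons ?big_nil ?mul1g.
  - by rewrite mulgA; case: eqP => [->|_]; rewrite ?big_cons ?mul1g.
  - by case: eqP => [->|_]; rewrite ?big_cons ?mul1g.
case: l => [h|b]; first exact: inl_act.
case: t => [|[k|c] t] /=; rewrite ?big_cons //.
case: eqP => [_|bc]; first by rewrite !big_cons.
by case: b c bc => [] [] //= _; rewrite mulgA ?mulVg ?mulgV mul1g.
Qed.

Definition ideal (H : set A) (g : A) : set (equation A) :=
  [set w | coeffs_in H w /\ phi g w = 1].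

Definition depends_on (g : A) (H : set A) : Prop := ideal H g <> [set 1].

End Ideal.

(* The orientation of the edges is auxiliary: paths may traverse an edge in
   either direction. *)
Record pgraph := PGraph {
  vertex : Type;
  edge : Type;
  origin : edge -> vertex;
  terminus : edge -> vertex;
  base : vertex
}.

Section Paths.
Variable X : pgraph.

(* (e, false) is e with its orientation, (e, true) is e reversed. *)
Definition dart : Type := (edge X * bool)%type.
Definition dinv (d : dart) : dart := (d.1, ~~ d.2).
Definition dsrc (d : dart) : vertex X := if d.2 then terminus d.1 else origin d.1.
Definition dtgt (d : dart) : vertex X := if d.2 then origin d.1 else terminus d.1.

(* A combinatorial path of length l is the sequence of the l darts that it
   traverses. The empty sequence is the constant path. *)
Fixpoint is_path (v : vertex X) (p : seq dart) (w : vertex X) : Prop :=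
  if p is d :: p' then dsrc d = v /\ is_path (dtgt d) p' w else v = w.

Definition is_loop (p : seq dart) : Prop := is_path (base X) p (base X).

(* A path fails to be locally injective exactly where it backtracks. *)
Definition path_reduced (p : seq dart) : Prop :=
  forall p1 d p2, p <> p1 ++ d :: dinv d :: p2.

(* In a graph, homotopy of loops relative to the endpoints is generated by
   inserting and deleting backtracks. *)
Inductive homotopic : seq dart -> seq dart -> Prop :=
| homotopic_refl p : is_loop p -> homotopic p p
| homotopic_sym p q : homotopic p q -> homotopic q p
| homotopic_trans p q r : homotopic p q -> homotopic q r -> homotopic p r
| homotopic_backtrack p d q : is_loop (p ++ d :: dinv d :: q) ->
    homotopic (p ++ d :: dinv d :: q) (p ++ q).

Lemma is_path_cat u p q w :
  is_path u (p ++ q) w <-> exists2 v, is_path u p v & is_path v q w.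
Proof.
elim: p u => [|d p IHp] u /=; first by split=> [?|[v -> //]]; exists u.
split=> [[-> /IHp[v pv qv]]|[v [-> pv] qv]]; first by exists v.
by split=> //; apply/IHp; exists v.
Qed.

(* The number of edges; 0 by convention if there are infinitely many. *)
Definition num_edges : nat := xget 0%N [set L | [set: edge X] #= `I_L].

Lemma num_edges_eq L : [set: edge X] #= `I_L -> num_edges = L.
Proof.
move=> XL; rewrite /num_edges; case: xgetP => [M _ /= XM|/(_ L)//].
have := card_eq_trans (card_esym XM) XL.
by move=> /card_eq_II.
Qed.

End Paths.

Section Core.
Variable X : pgraph.

Definition core_vertex (v : vertex X) : Prop := exists p q,
  [/\ is_path (base X) p v, is_path v q (base X) & path_reduced (p ++ q)].

Definition core_edge (e : edge X) : Prop := exists p b q,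
  is_loop (p ++ (e, b) :: q) /\ path_reduced (p ++ (e, b) :: q).

Fact core_base_subproof : core_vertex (base X).
Proof. by exists [::], [::]; split=> // -[]. Qed.

Fact core_dart_subproof p (d : dart X) q :
    is_loop (p ++ d :: q) -> path_reduced (p ++ d :: q) ->
  core_vertex (dsrc d) /\ core_vertex (dtgt d).
Proof.
move=> /is_path_cat[v pv [dv qv]] r; subst v; split; first by exists p, (d :: q).
exists (rcons p d), q; rewrite cat_rcons; split=> //.
by rewrite -cats1; apply/is_path_cat; exists (dsrc d).
Qed.

Fact core_origin_subproof e : core_edge e -> core_vertex (origin e).
Proof. by move=> [p [[] [q [/core_dart_subproof/[apply] -[]]]]]. Qed.

Fact core_terminus_subproof e : core_edge e -> core_vertex (terminus e).
Proof. by move=> [p [[] [q [/core_dart_subproof/[apply] -[]]]]]. Qed.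

(* The union of the images of all reduced loops at the base point. Since the
   constant loop is allowed, this is a point if all other loops backtrack. *)
Definition core : pgraph := {|
  vertex := {v : vertex X | core_vertex v};
  edge := {e : edge X | core_edge e};
  origin := fun e => exist _ _ (core_origin_subproof (svalP e));
  terminus := fun e => exist _ _ (core_terminus_subproof (svalP e));
  base := exist _ _ core_base_subproof |}.

End Core.

Section Cov.
Variables (n : nat) (K : set (freeGroup n)).

Definition is_rcoset (C : set (freeGroup n)) : Prop :=
  exists v, C = [set k * v | k in K].

Definition rcoset : Type := {C : set (freeGroup n) | is_rcoset C}.

Fact rcoset_base_subproof : is_rcoset K.
Proof.
exists 1; apply/seteqP; split=> [k Kk|_ [k Kk <-]]; last by rewrite mulg1.
by exists k => //; rewrite mulg1.
Qed.

Fact rcoset_mul_subproof (C : rcoset) a : is_rcoset [set c * a | c in sval C].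
Proof.
case: C => _ /= [v ->]; exists (v * a); apply/seteqP.
split=> [_ [_ [k Kk <-] <-]|_ [k Kk <-]]; first by exists k => //; rewrite mulgA.
by exists (k * v); [exists k|rewrite mulgA].
Qed.

(* The pointed covering of the rose with fundamental group K is the Schreier
   graph of K: the edge (C, i), labeled by a_i, goes from the coset C to C a_i. *)
Definition cov : pgraph := {|
  vertex := rcoset;
  edge := (rcoset * 'I_n)%type;
  origin := fun e => e.1;
  terminus := fun e => exist _ _ (rcoset_mul_subproof e.1 (fgen e.2));
  base := exist _ _ rcoset_base_subproof |}.

Definition core_star : pgraph := core cov.

(* The class in F_n of the image of a path under core_star -> R_n. *)
Definition path_label (p : seq (dart core_star)) : freeGroup n :=
  \prod_(d <- p) sgnpow d.2 (fgen (sval d.1).2).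

End Cov.

Section Wedge.
Variables X Y : pgraph.

(* A vertex of the wedge is a vertex of X or of Y, paired with the base point
   of the other graph. *)
Definition wedge_vertex : Type :=
  {v : vertex X * vertex Y | v.1 = base X \/ v.2 = base Y}.

Definition wedge_inl (v : vertex X) : wedge_vertex :=
  exist _ (v, base Y) (or_intror erefl).
Definition wedge_inr (v : vertex Y) : wedge_vertex :=
  exist _ (base X, v) (or_introl erefl).

Definition wedge : pgraph := {|
  vertex := wedge_vertex;
  edge := (edge X + edge Y)%type;
  origin := fun e =>
    match e with
    | inl e => wedge_inl (origin e)
    | inr e => wedge_inr (origin e)
    end;
  terminus := fun e =>
    match e with
    | inl e => wedge_inl (terminus e)
    | inr e => wedge_inr (terminus e)
    end;
  base := wedge_inl (base X) |}.

Definition path_inl (p : seq (dart X)) : seq (dart wedge) :=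
  [seq (inl d.1, d.2) | d <- p].
Definition path_inr (p : seq (dart Y)) : seq (dart wedge) :=
  [seq (inr d.1, d.2) | d <- p].

End Wedge.

Section EquationPath.
Variables (n : nat) (H : set (freeGroup n)) (g : freeGroup n).

Definition eq_graph : pgraph := wedge (core_star H) (core_star (gen_by [set g])).

(* p is a loop of one of the two summands that represents the image of the
   letter l under theta. *)
Definition letter_loop (l : freeGroup n + bool) (p : seq (dart eq_graph)) : Prop :=
  match l with
  | inl h => exists q : seq (dart (core_star H)),
      [/\ is_loop q, path_label q = h & p = path_inl _ q]
  | inr b => exists q : seq (dart (core_star (gen_by [set g]))),
      [/\ is_loop q, path_label q = sgnpow b g & p = path_inr _ q]
  end.

Fixpoint word_loop (w : seq (freeGroup n + bool)) (p : seq (dart eq_graph)) :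
    Prop :=
  if w is l :: w' then
    exists p1 p2, [/\ letter_loop l p1, word_loop w' p2 & p = p1 ++ p2]
  else p = [::].

(* The homotopy class theta(w), as a set of loops at the base point. *)
Definition theta (w : equation (freeGroup n)) : set (seq (dart eq_graph)) :=
  [set p | exists2 q, word_loop (eqword w) q & homotopic q p].

Definition equation_path (w : equation (freeGroup n))
    (s : seq (dart eq_graph)) : Prop :=
  theta w s /\ path_reduced s.

End EquationPath.

(* Main.v *)
Require Import Defs.
From mathcomp Require Import all_boot zify.
From mathcomp Require Import boolp classical_sets cardinality.

Set Implicit Arguments.
Unset Strict Implicit.
Unset Printing Implicit Defensive.

(* Take a cyclically reduced equation of degree d in the ideal whose total
   length is minimal, the length being that of the word E in F_n obtained by
   spelling out every coefficient and every g^(+-1).  Since E is trivial in F_n,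
   its positions carry a noncrossing matching of mutually inverse letters.
   Suppose that two matched pairs join the same two coefficients h and k, and
   traverse the same dart of core_*(H) at the h end and the same dart at the k
   end.  The pairs are nested, so the two closed paths between them can be
   excised from h and k at once: the new coefficients are non-trivial elements
   of H, the value of the equation is still 1, and the x-letters, hence the
   degree and cyclic reducedness, are untouched.  Minimality excludes this, so
   the pairs between coefficients are at most (2d)^2 (2L)^2 in number, there
   being at most 2d letters and 2L darts.  All other pairs involve one of the
   d|g| letters spelled by the x's, and |g| <= 2L: a dart repeated in the loop
   of g could be excised too, giving a non-trivial power of g shorter than g. *)

(** * Words in a free group *)

Section FreeWords.
Variable n : nat.
Local Notation L := ('I_n * bool)%type.
Local Open Scope group_scope.
Implicit Types (s t : seq L) (l : L) (u v : freeGroup n).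

Definition letter l : freeGroup n := sgnpow l.2 (fgen l.1).

Definition ev s : freeGroup n := \prod_(l <- s) letter l.

Lemma ev_nil : ev [::] = 1.
Proof. by rewrite /ev big_nil. Qed.

Lemma ev_cons l s : ev (l :: s) = letter l * ev s.
Proof. by rewrite /ev big_cons. Qed.

Lemma ev_cat s t : ev (s ++ t) = ev s * ev t.
Proof. by rewrite /ev big_cat. Qed.

Lemma ev_seq1 l : ev [:: l] = letter l.
Proof. by rewrite ev_cons ev_nil mulg1. Qed.

Lemma letterE l : fgword (letter l) = [:: l].
Proof. by case: l => i []. Qed.

Lemma fgword_ev s : fgword (ev s) = fg_mulw s [::].
Proof.
elim: s => [|l s IHs]; first by rewrite ev_nil.
by rewrite ev_cons -[LHS]/(fg_mulw (letter l) (ev s)) letterE IHs.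
Qed.

Lemma ev_reduced s : fg_reduced s -> fgword (ev s) = s.
Proof. by move=> rs; rewrite fgword_ev fg_mulw1. Qed.

Lemma ev_fgword u : ev (fgword u) = u.
Proof. by apply: val_inj; rewrite /= ev_reduced //; apply: valP. Qed.

Lemma letter_linv l : letter (fg_linv l) = (letter l)^-1.
Proof. by case: l => i [] //=; rewrite /letter /= invgK. Qed.

Lemma ev_invw s : ev (fg_invw s) = (ev s)^-1.
Proof.
elim: s => [|l s IHs]; first by rewrite ev_nil invg1.
by rewrite /fg_invw /= rev_cons -cats1 ev_cat ev_seq1 -/(fg_invw s) IHs
  letter_linv ev_cons invgM.
Qed.

Lemma ev_inj s t : fg_reduced s -> fg_reduced t -> ev s = ev t -> s = t.
Proof. by move=> rs rt E; rewrite -(ev_reduced rs) E ev_reduced. Qed.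

Lemma reduced_cat s t : fg_reduced (s ++ t) -> fg_reduced s && fg_reduced t.
Proof.
rewrite /fg_reduced; case: s => //= l s; rewrite cat_path => /andP[-> /=].
exact: path_sorted.
Qed.

Lemma reduced_glue s l t :
  fg_reduced (rcons s l) -> fg_reduced (l :: t) -> fg_reduced (s ++ l :: t).
Proof.
rewrite /fg_reduced; case: s => //= k s.
by rewrite rcons_path cat_path /= => /andP[-> ->].
Qed.

Lemma reducedPn s :
  ~~ fg_reduced s -> exists s1 l s2, s = s1 ++ l :: fg_linv l :: s2.
Proof.
elim: s => [|l [|m s] IHs] //=.
rewrite /fg_reduced /= negb_and => /orP[|Nr].
  by rewrite /fg_compat negbK => /eqP->; exists [::], l, s.
by have [s1 [k [s2 ->]]] := IHs Nr; exists (l :: s1), k, s2.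
Qed.

Lemma reduced_backtrack s1 l s2 : ~~ fg_reduced (s1 ++ l :: fg_linv l :: s2).
Proof.
by apply/negP => /reduced_cat /andP[_]; rewrite /fg_reduced /= /fg_compat eqxx.
Qed.

(** * Noncrossing matchings of words with trivial value *)

Section Matching.
Variable s : seq L.
Hypothesis ev1 : ev s = 1.

(* Evaluating s from the right with a stack, Q i is the stack before position i;
   a push is matched with the first return to the stack that it was put on. *)
Let Q i := fgword (ev (drop i s)).

Let Q0 : Q 0 = [::].
Proof. by rewrite /Q drop0 ev1. Qed.

Let Qend : Q (size s) = [::].
Proof. by rewrite /Q drop_size ev_nil. Qed.

Let Qstep z i : i < size s -> Q i = fg_act (nth z s i) (Q i.+1).
Proof.
move=> si; rewrite /Q (drop_nth z si) ev_cons.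
by rewrite -[LHS]/(fg_mulw (letter _) (ev _)) letterE.
Qed.

Let push i := (i < size s) && (size (Q i.+1) < size (Q i)).

Let pushP z i : push i -> Q i = nth z s i :: Q i.+1.
Proof.
case/andP => si; rewrite (Qstep z si) /fg_act.
by case: (Q i.+1) => [|m w] //; case: ifP => //= _; lia.
Qed.

Let popP z i : i < size s -> ~~ push i -> Q i.+1 = fg_linv (nth z s i) :: Q i.
Proof.
rewrite /push => si; rewrite si (Qstep z si) /fg_act.
case: (Q i.+1) => [|m w] //; case: eqP => [-> //|_ /=]; lia.
Qed.

(** Going left from [j], the pushed letter and all below it stay on the stack until a pop first
    uncovers [Q j.+1]. Such a pop must come, since the stack is empty at position 0. *)
Let push_return z j : push j -> exists i,
  [/\ i < j, Q i = Q j.+1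
    & forall k, i < k <= j -> suffix (nth z s j :: Q j.+1) (Q k)].
Proof.
move=> pj; have sj : j < size s by case/andP: pj.
set T := nth z s j :: Q j.+1.
have H (t : nat) : t <= j -> (exists i, [/\ i < j, Q i = Q j.+1
    & forall k, i < k <= j -> suffix T (Q k)]) \/
    forall k, j - t <= k <= j -> suffix T (Q k).
  elim: t => [|t IHt] tj.
    right=> k; rewrite subn0 => jkj; have -> : k = j by lia.
    by rewrite (pushP z pj) suffix_refl.
  case: (IHt (ltnW tj)) => [|{}H]; [by left|].
  have [k0 Ek0] : exists k0, j - t = k0.+1 by exists (j - t.+1); lia.
  have sufk : suffix T (Q k0.+1) by apply: H; lia.
  have sk0 : k0 < size s by lia.
  case: (boolP (push k0)) => [pk|npk].
    right=> k kj; case: (ltngtP k k0) => [|kk|->]; [lia|apply: H; lia|].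
    rewrite (pushP z pk); apply: suffix_trans sufk _.
    exact: (suffix_suffix [:: _]).
  move: sufk; rewrite (popP z sk0 npk) => /suffixP[[|a r]] /=.
    case=> _ Er; left; exists k0; split; [lia|by []|].
    by move=> k kj; apply: H; lia.
  case=> _ Er; right=> k kj.
  case: (ltngtP k k0) => [|kk|->]; [lia|apply: H; lia|].
  by rewrite Er suffix_suffix.
case: (H j (leqnn j)) => [//|/(_ 0)]; rewrite Q0 subnn => /(_ isT) /suffixP.
by case=> -[].
Qed.

(** [P] selects the pushes, and [m] sends a push to the pop that removes its letter. The equality of
    suffix values makes the segment from [m j] to [j] trivial. The last clause is noncrossing: a
    pair whose right end lies inside another pair has its left end there too. *)
Lemma noncrossing_matching : exists (P : pred nat) (m : nat -> nat),
  [/\ size s = (count P (iota 0 (size s))).*2,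
      forall z j, P j -> [/\ m j < j < size s,
        nth z s (m j) = fg_linv (nth z s j)
        & ev (drop (m j) s) = ev (drop j.+1 s)]
    & forall j k, P j -> P k -> k < j ->
        m j <> m k /\ (m j < k -> m j < m k)].
Proof.
have [s0|[z sz]] : s = [::] \/ exists z, z \in s.
- by case: s => [|z r]; [left|right; exists z; rewrite mem_head].
- by exists pred0, id; rewrite count_pred0 s0; split.
have /boolp.choice[m mP] : forall j, exists i, push j ->
    [/\ i < j, Q i = Q j.+1
      & forall k, i < k <= j -> suffix (nth z s j :: Q j.+1) (Q k)].
  move=> j; case: (boolP (push j)) => [/(push_return z)[i ?]|_]; first by exists i.
  by exists 0%N.
exists push, m; split.
(* A push raises the stack by one and a pop lowers it by one, so the height plus the number of
   positions read is twice the number of pushes. *)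
- have H (t : nat) : t <= size s ->
      size (Q t) + (size s - t) = (count push (iota t (size s - t))).*2.
    move=> ts; rewrite -(subKn ts); move: (size s - t) (leq_subr t (size s)).
    elim=> [|r IHr] rs; first by rewrite !subn0 subnn Qend.
    have Es : size s - (size s - r.+1) = (size s - (size s - r)).+1 by lia.
    have Et : (size s - r.+1).+1 = size s - r by lia.
    have {}IHr := IHr (ltnW rs).
    rewrite Es /= Et; have st : size s - r.+1 < size s by lia.
    case: (boolP (push (size s - r.+1))) => [p|np].
      by rewrite (pushP z p) /= Et addSn addnS IHr add1n doubleS.
    have := popP z st np; rewrite Et => E; move: IHr.
    by rewrite [in size (Q _)]E addnS -addSn.
  by have := H 0 isT; rewrite Q0 subn0.
- move=> z' j pj; have [mj Em suf] := mP j pj.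
  have sj : j < size s by case/andP: pj.
  rewrite mj sj; split=> //; last by apply: val_inj.
  have sm : m j < size s by apply: ltn_trans sj.
  rewrite !(set_nth_default z z') //.
  have npm : ~~ push (m j).
    apply/negP => /(pushP z) E.
    have /size_suffix /= : suffix (nth z s j :: Q j.+1) (Q (m j).+1).
      by apply: suf; lia.
    by have := f_equal size E; rewrite Em /=; lia.
  have /suffixP[r] : suffix (nth z s j :: Q j.+1) (Q (m j).+1).
    by apply: suf; lia.
  rewrite (popP z sm npm) Em; case: r => [|a r] /=.
    by case=> <-; rewrite fg_linvK.
  by case=> _ /(f_equal size); rewrite size_cat /=; lia.
(* If [m k] were left of [m j], the letter pushed at [k] would still be on the stack at [m j], which
   would then be higher than [Q j.+1], to which it has just returned. *)
- have main j k : push j -> push k -> k < j -> m j < k -> m j < m k.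
    move=> pj pk kj mjk; have [_ Ej sufj] := mP j pj.
    have [mk Ek sufk] := mP k pk.
    have /size_suffix /= : suffix (nth z s j :: Q j.+1) (Q k.+1).
      by apply: sufj; lia.
    case: (ltngtP (m j) (m k)) => [//|lt|E].
      have /size_suffix /= : suffix (nth z s k :: Q k.+1) (Q (m j)).
        by apply: sufk; lia.
      by rewrite Ej; lia.
    by rewrite -Ek -E Ej; lia.
  move=> j k pj pk kj; split; last exact: main.
  move=> E; have [mk _ _] := mP k pk.
  by have := main j k pj pk kj; rewrite E => /(_ mk); rewrite ltnn.
Qed.

End Matching.

(** Powers of a cyclically reduced word are plain concatenations; the general case follows by
    peeling off conjugating letters one pair at a time. *)
Lemma size_expg_ge (g : freeGroup n) m :
  g <> 1 -> size g <= size (fgword (g ^+ m.+1)).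
Proof.
(* The power keeps the first and last letters of [s], so that putting a conjugating pair back around
   it gives a reduced word again. *)
suff H k s : size s <= k -> s != [::] -> fg_reduced s -> exists t,
    [/\ fgword (ev s ^+ m.+1) = t, size s <= size t
      & forall l, head l t = head l s /\ last l t = last l s].
  move=> g1; have [||t [E st _]] := H (size g) g (leqnn _).
  - by apply/eqP => E; apply: g1; apply: val_inj.
  - exact: valP.
  by move: E st; rewrite ev_fgword => ->.
elim: k s => [|k IHk] s; first by case: s.
case: s => // a s sk _ rs.
case: (boolP (cycle (@fg_compat n) (a :: s))) => cs.
  pose p r := flatten (nseq r (a :: s)).
  have pE r : ev (p r) = ev (a :: s) ^+ r.
    by elim: r => [|r IHr]; rewrite ?ev_nil // expgS -IHr -ev_cat.
  have pr r : path (@fg_compat n) (last a s) (p r) /\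
      last (last a s) (p r) = last a s.
    elim: r => [|r [IHp IHl]] //=; rewrite last_cat IHl; split=> //.
    move: cs; rewrite /= rcons_path => /andP[ps ->].
    by rewrite cat_path ps IHp.
  exists (p m.+1); rewrite -pE ev_reduced; last exact: path_sorted (pr _).1.
  split=> //=; first by rewrite size_cat; lia.
  move=> l; split=> //; rewrite last_cat.
  exact: (pr _).2.
case/lastP: s sk rs cs => [|s b] sk rs cs.
  by move: cs; rewrite /= /fg_compat; case: (a) => i []; rewrite xpair_eqE andbF.
have /eqP Ea : a == fg_linv b.
  apply: contraR cs => ab; rewrite /= rcons_path.
  by move: rs; rewrite /fg_reduced /= last_rcons => ->.
have s0 : s != [::].
  apply/eqP => E; move: rs; rewrite E Ea /fg_reduced /= /fg_compat fg_linvK.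
  by rewrite eqxx.
have rs' : fg_reduced s.
  move: rs; rewrite -rcons_cons -cats1 => /reduced_cat/andP[+ _].
  exact: path_sorted.
have [|t [Et st hl]] := IHk s _ s0 rs'.
  by move: sk; rewrite /= size_rcons; lia.
exists (a :: rcons t b).
split; last by move=> l; rewrite /= !last_rcons.
  rewrite ev_cons -cats1 ev_cat ev_seq1.
  have -> : letter a = (letter b)^-1 by rewrite Ea letter_linv.
  have -> r : ((letter b)^-1 * (ev s * letter b)) ^+ r =
      (letter b)^-1 * (ev s ^+ r * letter b).
    elim: r => [|r IHr]; first by rewrite mul1g mulVg.
    by rewrite !expgS IHr -!mulgA mulVKg.
  have -> : ev s ^+ m.+1 = ev t by rewrite -Et ev_fgword.
  rewrite -letter_linv -Ea -(ev_seq1 b) -ev_cat -ev_cons.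
  rewrite cats1 ev_reduced //.
  have rt : fg_reduced t by rewrite -Et; apply: valP.
  case: (t) st hl rt => [|c t'] st hl rt; first by case: (s) s0 st.
  have [Eh _] := hl a; have [_ El] := hl c.
  rewrite /fg_reduced /= rcons_path; move: rt; rewrite /fg_reduced /= => ->.
  case: (s) s0 rs Eh El => // d s'' _ /=; rewrite rcons_path.
  by move=> /and3P[ad _ db] -> ->; rewrite ad db.
by rewrite /= !size_rcons; lia.
Qed.

(** The powers of [g] and their inverses already form a subgroup, and inversion preserves length. *)
Lemma size_gen1_ge (g h : freeGroup n) : g <> 1 -> gen_by [set g]%classic h -> h <> 1 ->
  size g <= size h.
Proof.
move=> g1; pose K : set (freeGroup n) :=
  [set h | exists b m, h = sgnpow b (g ^+ m)]%classic.
have KE i j : K (g ^+ i * (g ^+ j)^-1).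
  case: (leqP j i) => ij.
    by exists false, (i - j)%N; rewrite /= expgnFr.
  by exists true, (j - i)%N; rewrite /= expgnFr ?invgF // ltnW.
suff sK : (gen_by [set g] `<=` K)%classic.
  move=> /sK[b [[|m] ->]] h1.
    by case: h1; case: b; rewrite /= ?invg1.
  apply: leq_trans (size_expg_ge m g1) _.
  by case: b {h1} => //=; rewrite /fg_invw size_rev size_map.
apply: smallest_sub; last by move=> _ ->; exists false, 1%N.
have C i j : g ^+ i * g ^+ j = g ^+ j * g ^+ i by rewrite -!expgnDr addnC.
split; first by rewrite in_setE; exists false, 0%N.
move=> x y; rewrite !in_setE => -[b [i ->]] [c [j ->]].
case: b c => [] [] /=; rewrite ?invgK.
- suff -> : (g ^+ i)^-1 * g ^+ j = g ^+ j * (g ^+ i)^-1 by exact: KE.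
  by apply: (mulgI (g ^+ i)); rewrite mulVKg mulgA C mulgK.
- exists true, (j + i)%N; by rewrite /= expgnDr invgM.
- by exists false, (i + j)%N; rewrite /= expgnDr.
- exact: KE.
Qed.

End FreeWords.

(** * Schreier graphs and their cores *)

Section Subgroups.
Variables (A : groupType) (K : set A).
Hypothesis subK : is_subgroup K.
Local Open Scope group_scope.
Implicit Types u v : A.

Lemma subgroup1 : K 1.
Proof. by case: subK; rewrite in_setE. Qed.

Lemma subgroupV u : K u -> K u^-1.
Proof. by move=> /mem_set /(group_closedV subK) /set_mem. Qed.

Lemma subgroupM u v : K u -> K v -> K (u * v).
Proof.
by move=> /mem_set Ku /mem_set Kv; apply/set_mem/(group_closedM subK).
Qed.

End Subgroups.

(** * Lifting words to the Schreier graph *)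

Section Walks.
Variables (n : nat) (K : set (freeGroup n)).
Hypothesis subK : is_subgroup K.
Local Notation L := ('I_n * bool)%type.
Local Open Scope group_scope.
Implicit Types (s t : seq L) (l : L) (u v h : freeGroup n).

Definition coset v : rcoset K :=
  exist _ _ (ex_intro (fun w => _ = [set k * w | k in K]%classic) v erefl).

Lemma eq_coset u v : coset u = coset v <-> K (v * u^-1).
Proof.
split=> [E|Kvu].
  have : sval (coset u) v.
    by rewrite E /=; exists 1; [exact: (subgroup1 subK)|rewrite mul1g].
  by case=> k Kk <-; rewrite mulgK.
apply: eq_exist; apply/seteqP; split=> _ [k Kk <-].
  exists (k * (v * u^-1)^-1); first exact/(subgroupM subK)/(subgroupV subK).
  by rewrite invgF -mulgA mulgVK.
by exists (k * (v * u^-1)); [exact: (subgroupM subK)|rewrite -mulgA mulgVK].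
Qed.

Lemma base_cov : base (cov K) = coset 1.
Proof.
apply: eq_exist; apply/seteqP; split=> [k Kk|_ [k Kk <-]]; last by rewrite mulg1.
by exists k; rewrite ?mulg1.
Qed.

Lemma coset_mul v a :
  exist _ _ (rcoset_mul_subproof (coset v) a) = coset (v * a).
Proof.
apply: eq_exist; apply/seteqP; split=> [_ [_ [k Kk <-] <-]|_ [k Kk <-]].
  by exists k => //; rewrite mulgA.
by exists (k * v); [exists k|rewrite mulgA].
Qed.

Lemma cosetP (C : rcoset K) : exists v, C = coset v.
Proof. by case: C => C [v E]; exists v; apply: eq_exist. Qed.

(** The dart labeled [l] that leaves the coset of [v]. For an inverse letter the underlying edge
    ends at that coset and is run backwards. *)
Definition dart_at v l : dart (cov K) :=
  ((coset (if l.2 then v * (fgen l.1)^-1 else v), l.1), l.2).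

Definition dlab (d : dart (cov K)) : L := (d.1.2, d.2).

(** The lift of the word [s] that starts at the coset of [v]; by [walk_coset] the choice of
    representative does not matter. *)
Fixpoint walk v s : seq (dart (cov K)) :=
  if s is l :: s' then dart_at v l :: walk (v * letter l) s' else [::].

Lemma dsrc_dart_at v l : dsrc (dart_at v l) = coset v.
Proof. by case: l => i []; rewrite /dsrc /= ?coset_mul ?mulgVK. Qed.

Lemma dtgt_dart_at v l : dtgt (dart_at v l) = coset (v * letter l).
Proof. by case: l => i []; rewrite /dtgt /= ?coset_mul. Qed.

Lemma dart_at_eq v (d : dart (cov K)) : dsrc d = coset v -> d = dart_at v (dlab d).
Proof.
case: d => [[C i] []]; rewrite /dsrc /dart_at /dlab /=; last by move->.
have [w ->] := cosetP C; rewrite coset_mul => /eq_coset E.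
congr (_, _, _); apply/eq_coset.
by move: E; rewrite invgM mulgA.
Qed.

Lemma dart_at_coset u v l : coset u = coset v -> dart_at u l = dart_at v l.
Proof.
move=> E; rewrite [LHS](@dart_at_eq v); last by rewrite dsrc_dart_at.
by case: l.
Qed.

Lemma coset_mulr u v a : coset u = coset v -> coset (u * a) = coset (v * a).
Proof. by move=> E; rewrite -!coset_mul; apply: eq_exist; rewrite E. Qed.

Lemma walk_coset u v s : coset u = coset v -> walk u s = walk v s.
Proof.
elim: s u v => //= l s IHs u v E; rewrite (dart_at_coset l E).
by rewrite (IHs _ (v * letter l)) //; exact: coset_mulr.
Qed.

Lemma dinv_dart_at v l : dinv (dart_at v l) = dart_at (v * letter l) (fg_linv l).
Proof.
by case: l => i []; rewrite /dinv /dart_at /letter /= ?mulgVK ?mulgK.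
Qed.

Lemma walk_cat v s t : walk v (s ++ t) = walk v s ++ walk (v * ev s) t.
Proof.
elim: s v => [|l s IHs] v /=; first by rewrite ev_nil mulg1.
by rewrite IHs ev_cons mulgA.
Qed.

Lemma map_dlab_walk v s : map dlab (walk v s) = s.
Proof. by elim: s v => //= -[i b] s IHs v; rewrite IHs. Qed.

Lemma size_walk v s : size (walk v s) = size s.
Proof. by rewrite -(size_map dlab) map_dlab_walk. Qed.

Lemma is_path_walk v s : is_path (X := cov K) (coset v) (walk v s) (coset (v * ev s)).
Proof.
elim: s v => [|l s IHs] v /=; first by rewrite ev_nil mulg1.
by rewrite dsrc_dart_at dtgt_dart_at ev_cons mulgA.
Qed.

(** Unique path lifting: a dart is determined by its source and its label. *)
Lemma is_path_covP v (p : seq (dart (cov K))) w : is_path (X := cov K) (coset v) p w ->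
  p = walk v (map dlab p) /\ w = coset (v * ev (map dlab p)).
Proof.
elim: p v => [|d p IHp] v /=; first by rewrite ev_nil mulg1.
case=> /dart_at_eq Ed.
have -> : dtgt d = coset (v * letter (dlab d)) by rewrite {1}Ed dtgt_dart_at.
by move=> /IHp[Ep ->]; rewrite -Ep -Ed ev_cons mulgA.
Qed.

Lemma is_loop_walk s : is_loop (walk 1 s) <-> K (ev s).
Proof.
rewrite /is_loop base_cov; split.
  move=> /is_path_covP[_]; rewrite map_dlab_walk mul1g => /eq_coset.
  by rewrite invg1 mulg1.
move=> Ks; have E : coset 1 = coset (1 * ev s).
  by apply/eq_coset; rewrite mul1g invg1 mulg1.
rewrite [in X in is_path _ _ X]E; exact: is_path_walk.
Qed.

(** Coverings are locally injective, so backtracks of the lift are exactly cancellations in the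
    word. *)
Lemma walk_reduced v s : path_reduced (walk v s) <-> fg_reduced s.
Proof.
split=> [rp|rs p1 d p2 E]; last first.
  move: rs; rewrite -(map_dlab_walk v s) E map_cat /=.
  by rewrite (_ : dlab (dinv d) = fg_linv (dlab d)) //
    (negbTE (reduced_backtrack _ _ _)).
apply/negP => /negP /reducedPn[s1 [l [s2 E]]].
apply: (rp (walk v s1) (dart_at (v * ev s1) l)
  (walk (v * ev s1 * letter l * letter (fg_linv l)) s2)).
by rewrite E walk_cat /= dinv_dart_at.
Qed.

Lemma core_edge_walk s1 l s2 : fg_reduced (s1 ++ l :: s2) ->
  K (ev (s1 ++ l :: s2)) -> core_edge (dart_at (ev s1) l).1.
Proof.
move=> rs Ks; exists (walk 1 s1), l.2, (walk (ev s1 * letter l) s2).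
have -> : walk 1 s1 ++ ((dart_at (ev s1) l).1, l.2) :: walk (ev s1 * letter l) s2 =
    walk 1 (s1 ++ l :: s2) by rewrite walk_cat /= mul1g.
by split; [apply/is_loop_walk|apply/walk_reduced].
Qed.

Lemma core_edgeP (e : edge (cov K)) :
  core_edge e -> exists2 h, K h & List.In e (map fst (walk 1 (fgword h))).
Proof.
case=> p [b [q [lo re]]]; have := lo.
rewrite /is_loop base_cov => /is_path_covP[]; set s := map dlab _ => Ep _.
have rs : fg_reduced s by apply/(@walk_reduced 1); rewrite -Ep.
exists (ev s); first by apply/is_loop_walk; rewrite -Ep.
rewrite ev_reduced // -Ep map_cat /=; elim: (map fst p) => [|a r IHr] /=.
  by left.
by right.
Qed.

Definition forget (d : dart (core_star K)) : dart (cov K) := (sval d.1, d.2).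

Lemma is_path_forget (v w : vertex (core_star K)) p :
  is_path (sval v) (map forget p) (sval w) -> is_path v p w.
Proof.
elim: p v => [|d p IHp] v /=.
  by case: v w => [v cv] [w cw] /= E; apply: eq_exist.
case=> Ed; have -> : dtgt (forget d) = sval (dtgt d) by case: d {Ed} => e [].
move=> /IHp pd; split=> //; case: v Ed => v cv /= Ed.
by case: d Ed {pd} => e [] /= Ed; apply: eq_exist.
Qed.

Lemma path_label_forget p :
  path_label p = ev (map dlab (map forget p)).
Proof. by rewrite /path_label /ev !big_map. Qed.

(** The lift of the reduced word of [h] is itself a reduced loop, hence stays in the core. *)
Lemma loop_of_subgroup h : K h -> exists q : seq (dart (core_star K)),
  [/\ is_loop q, path_label q = h & size q = size h].
Proof.
move=> Kh; have lift (p : seq (dart (cov K))) :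
    (forall p1 d p2, p = p1 ++ d :: p2 -> core_edge d.1) ->
    exists q, map forget q = p.
  elim: p => [|d p IHp] H; first by exists [::].
  have [|q Eq] := IHp; first by move=> p1 e p2 E; apply: (H (d :: p1) e p2); rewrite E.
  have cd : core_edge d.1 by apply: (H [::] d p).
  exists ((exist _ d.1 cd, d.2) :: q); rewrite /= Eq /forget /=.
  by case: (d).
have [|q Eq] := lift (walk 1 (fgword h)).
  move=> p1 [e b] p2 E; exists p1, b, p2; rewrite -E.
  split; first by apply/is_loop_walk; rewrite ev_fgword.
  by apply/walk_reduced; apply: valP.
exists q; split.
- apply: is_path_forget; rewrite Eq.
  by apply/is_loop_walk; rewrite ev_fgword.
- by rewrite path_label_forget Eq map_dlab_walk ev_fgword.
- by rewrite -(size_map forget) Eq size_walk.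
Qed.

(* The code of a letter in a reduced word of K determines the dart of the core
   graph that this letter traverses. *)
Lemma dart_code (T : Type) (x0 : T) (f : edge (core_star K) -> T) : injective f ->
  exists code : seq L -> L -> T * bool, forall s1 l s2 t1 m t2,
    fg_reduced (s1 ++ l :: s2) -> K (ev (s1 ++ l :: s2)) ->
    fg_reduced (t1 ++ m :: t2) -> K (ev (t1 ++ m :: t2)) ->
    code s1 l = code t1 m -> l = m /\ K (ev t1 * (ev s1)^-1).
Proof.
(* Darts outside the core get the junk value [x0]; [core_edge_walk] excludes them for letters of
   reduced words of [K]. *)
move=> injf; pose c (d : dart (cov K)) := (match pselect (core_edge d.1) with
  left cd => f (exist _ d.1 cd) | right _ => x0 end, d.2).
exists (fun s l => c (dart_at (ev s) l)) => s1 l s2 t1 m t2 rs Ks rt Kt.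
have es := core_edge_walk rs Ks; have et := core_edge_walk rt Kt.
rewrite /c; case: pselect => // cs; case: pselect => // ct.
move=> [/injf /(congr1 sval) /= E1 E2].
have Ed : dart_at (ev s1) l = dart_at (ev t1) m by apply: injective_projections.
split.
  by have := congr1 dlab Ed; rewrite /dlab /= -!surjective_pairing.
by apply/eq_coset; rewrite -(dsrc_dart_at (ev s1) l) Ed dsrc_dart_at.
Qed.

(** * Finiteness of the core of a finitely generated subgroup *)

Local Notation edges v s := (map fst (walk v s)).

(** A cancellation drops two darts over one edge, and the walk goes on from the same coset. *)
Lemma edges_reduction e v s t :
  List.In e (edges v (fg_mulw s t)) -> List.In e (edges v (s ++ t)).
Proof.
have act u l w :
    List.In e (edges u (fg_act l w)) -> List.In e (edges u (l :: w)).
  case: w => //= k w; case: eqP => [->|//] /= H.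
  by right; right; rewrite letter_linv mulgK.
elim: s v => [//|l s IHs] v /= /act /= [<-|/IHs H]; [by left|by right].
Qed.

(** The lift of the inverse word retraces backwards the lift of [s] that ends at the coset of
    [v]. *)
Lemma edges_invw e v s :
  List.In e (edges v (fg_invw s)) -> List.In e (edges (v * (ev s)^-1) s).
Proof.
elim: s => //= l s IHs; rewrite /fg_invw /= rev_cons -cats1 walk_cat map_cat.
rewrite -/(fg_invw s) => /List.in_app_iff[/IHs|/=].
  by rewrite ev_cons invgM mulgA mulgVK; right.
case=> // <-; left; rewrite ev_invw ev_cons invgM mulgA.
have := dinv_dart_at (v * (ev s)^-1 * (letter l)^-1) l.
by rewrite mulgVK => /(congr1 fst).
Qed.

Lemma finite_walk v s : finite_set [set e | List.In e (edges v s)].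
Proof.
elim: s v => [|l s IHs] v /=; first exact: finite_set0.
rewrite (_ : [set e | _] = [set (dart_at v l).1] `|`
  [set e | List.In e (edges (v * letter l) s)])%classic.
  by rewrite finite_setU; split=> //; apply: finite_set1.
by apply/seteqP; split=> e /= [->|?]; [left|right|left|right].
Qed.

(** The elements of [K] whose loops use only edges met by the generators form a subgroup containing
    the generators, hence all of [K]; and each core edge lies on the loop of some element. *)
Lemma finite_core : finitely_generated K -> finite_set [set: edge (core_star K)].
Proof.
case=> gens EK.
pose E (us : seq (freeGroup n)) : set (edge (cov K)) :=
  [set e | exists2 u, u \in us & List.In e (edges 1 (fgword u))]%classic.
have finE us : finite_set (E us).
  elim: us => [|u us IHu].
    by apply: sub_finite_set (finite_set0 _) => e [].
  apply: (@sub_finite_set _ _ ([set e | List.In e (edges 1 (fgword u))] `|`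
    E us)%classic).
    by move=> e [w]; rewrite inE => /orP[/eqP->|]; [left|right; exists w].
  by rewrite finite_setU; split=> //; exact: finite_walk.
pose K' : set (freeGroup n) := [set h | K h /\
  forall e, List.In e (edges 1 (fgword h)) -> E gens e]%classic.
have KK' : (K `<=` K')%classic.
  rewrite {1}EK; apply: smallest_sub; last first.
    move=> u us; split; last by move=> e ?; exists u.
    by rewrite EK => K2 [_]; apply.
  split; first by rewrite in_setE; split=> //; exact: (subgroup1 subK).
  move=> u v; rewrite !in_setE => -[Ku Eu] [Kv Ev].
  have Kuv : K (u * v^-1) by apply: (subgroupM subK) => //; exact: (subgroupV subK).
  split=> // e; rewrite -[fgword _]/(fg_mulw u (fg_invw v)).
  move=> /edges_reduction; rewrite walk_cat map_cat => /List.in_app_iff[/Eu //|].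
  move=> /edges_invw H; apply: Ev; move: H.
  rewrite mul1g !ev_fgword; congr (List.In e (map fst _)).
  (* The retraced walk of [v] starts at the coset of [u * v^-1], which is the base point. *)
  by apply: walk_coset; apply/eq_coset; rewrite mul1g; apply: (subgroupV subK).
have coreE (e : edge (core_star K)) : E gens (sval e).
  by have [h /KK'[_]] := core_edgeP (svalP e); apply.
apply: (@sub_finite_set _ _
  ((fun e : edge (core_star K) => sval e) @^-1` E gens)%classic).
  by move=> e _; exact: coreE.
apply: finite_preimage (finE gens) => -[e1 c1] [e2 c2] _ _ /= E12.
exact: eq_exist.
Qed.

End Walks.

Lemma is_subgroup_gen_by (A : groupType) (S : set A) : is_subgroup (gen_by S).
Proof.
split; first by rewrite in_setE => B [[B1 _] _]; rewrite -in_setE.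
move=> x y; rewrite !in_setE => Sx Sy B SB.
by rewrite -in_setE; apply: SB.1.2; rewrite in_setE; [apply: Sx|apply: Sy].
Qed.

(** * Tightening loops, and loops in a wedge *)

Lemma reduce_loop (X : pgraph) (p : seq (dart X)) : is_loop p ->
  exists q, [/\ homotopic p q, path_reduced q & size q <= size p].
Proof.
have [k] := ubnP (size p); elim: k p => // k IHk p sp lp.
case: (pselect (path_reduced p)) => [rp|/existsNP[p1 /existsNP[d /existsNP[p2]]]].
  by exists p; split=> //; exact: homotopic_refl.
move=> /contrapT E; have hp : homotopic p (p1 ++ p2).
  by rewrite E; apply: homotopic_backtrack; rewrite -E.
have l12 : is_loop (p1 ++ p2).
  move: lp; rewrite E /is_loop => /is_path_cat[v pv] /= [dv [d'v qv]].
  apply/is_path_cat; exists v => //; move: qv.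
  by rewrite -dv; case: (d) => e [].
have sE : size p = (size (p1 ++ p2)).+2 by rewrite E !size_cat /= !addnS.
have [||q [hq rq sq]] := IHk (p1 ++ p2); rewrite ?sE //; first by lia.
exists q; split=> //; first exact: homotopic_trans hq.
by lia.
Qed.

Section WedgePaths.
Variables X Y : pgraph.

Lemma is_path_inl v p w : is_path v p w ->
  is_path (X := wedge X Y) (wedge_inl Y v) (path_inl Y p) (wedge_inl Y w).
Proof.
elim: p v => [|[e b] p IHp] v /=; first by move->.
by case=> <- /IHp; case: b.
Qed.

Lemma is_path_inr v p w : is_path v p w ->
  is_path (X := wedge X Y) (wedge_inr X v) (path_inr X p) (wedge_inr X w).
Proof.
elim: p v => [|[e b] p IHp] v /=; first by move->.
by case=> <- /IHp; case: b.
Qed.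

Lemma is_loop_inl (p : seq (dart X)) : is_loop p -> is_loop (path_inl Y p).
Proof. exact: is_path_inl. Qed.

Lemma is_loop_inr (p : seq (dart Y)) : is_loop p -> is_loop (path_inr X p).
Proof.
move=> /is_path_inr; rewrite /is_loop.
suff -> : wedge_inr X (base Y) = base (wedge X Y) by [].
exact: eq_exist.
Qed.

End WedgePaths.

Lemma is_loop_cat (X : pgraph) (p q : seq (dart X)) :
  is_loop p -> is_loop q -> is_loop (p ++ q).
Proof. by move=> lp lq; apply/is_path_cat; exists (base X). Qed.

(** * Excision in a minimal equation *)

Lemma seq_split2 (T : Type) (z : T) (s : seq T) i j : i < j < size s ->
  exists s1 s2 s3, [/\ s = s1 ++ nth z s i :: s2 ++ nth z s j :: s3,
    take i s = s1, take j s = s1 ++ nth z s i :: s2,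
    drop i.+1 s = s2 ++ nth z s j :: s3 & drop j.+1 s = s3].
Proof.
case/andP=> ij sj; have si : i < size s by apply: ltn_trans sj.
exists (take i s), (take (j - i.+1) (drop i.+1 s)), (drop j.+1 s).
have Ed : drop i.+1 s = take (j - i.+1) (drop i.+1 s) ++ nth z s j :: drop j.+1 s.
  rewrite -drop_nth //; have -> : drop j s = drop (j - i.+1) (drop i.+1 s).
    by rewrite drop_drop subnK.
  by rewrite cat_take_drop.
split=> //; first by rewrite -Ed -drop_nth // cat_take_drop.
rewrite -{1}(cat_take_drop i s) take_cat size_take si ltnNge (ltnW ij) /=.
by rewrite (drop_nth z si) -[j - i]prednK ?subn_gt0 //= -subnS.
Qed.

(** The cases [c = 0] and [c = 1] give the suffixes starting at position [i] and just after it; for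
    larger [c] the suffix could start inside a later block. *)
Lemma drop_flatten (T : Type) (ss : seq (seq T)) i c : i < size (flatten ss) ->
  let r := reshape_index (shape ss) i in
  c <= 1 -> drop (c + i) (flatten ss) =
    drop (c + reshape_offset (shape ss) i) (nth [::] ss r) ++ flatten (drop r.+1 ss).
Proof.
rewrite size_flatten => si r c1; have sr := reshape_indexP si; rewrite size_map in sr.
have := reshape_offsetP si; set o := reshape_offset _ _.
rewrite (nth_map [::]) // -/r => so.
have Ei : i = size (flatten (take r ss)) + o.
  by rewrite -[LHS](reshape_indexK (shape ss)) /flatten_index -map_take -size_flatten.
have -> : flatten ss = flatten (take r ss) ++ nth [::] ss r ++ flatten (drop r.+1 ss).
  by rewrite -{1}(cat_take_drop r ss) flatten_cat (drop_nth [::]).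
rewrite {1}Ei addnCA drop_cat ltnNge leq_addr /= addKn drop_cat.
case: ltngtP => [//|co|->]; first lia.
by rewrite subnn drop0 drop_size.
Qed.

(** The last hypothesis says that both occurrences of [l] leave the same vertex, so [l :: s2] is a
    closed path. Cutting it out creates no cancellation, as [l] is still followed by [s3], and
    leaves a non-empty word. *)
Lemma excise (n : nat) (K : set (freeGroup n)) (u : freeGroup n) s1 l s2 s3 :
  is_subgroup K -> K u -> fgword u = s1 ++ l :: s2 ++ l :: s3 ->
  K (ev (s1 ++ l :: s2) * (ev s1)^-1)%g ->
  [/\ K (ev (s1 ++ l :: s3)), ev (s1 ++ l :: s3) <> 1%g
    & fgword (ev (s1 ++ l :: s3)) = s1 ++ l :: s3].
Proof.
move=> subK Ku Eu Ks; have ru : fg_reduced (fgword u) by apply: valP.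
have rs : fg_reduced (s1 ++ l :: s3).
  apply: reduced_glue.
    by move: ru; rewrite Eu -cat_rcons => /reduced_cat/andP[].
  by move: ru; rewrite Eu -cat_cons catA => /reduced_cat/andP[].
split; last exact: ev_reduced.
  have -> : ev (s1 ++ l :: s3) = ((ev (s1 ++ l :: s2) * (ev s1)^-1)^-1 * u)%g.
    rewrite -(ev_fgword u) Eu -cat_cons catA [in RHS](ev_cat (s1 ++ _)) mulgA.
    by rewrite invgF mulgVK ev_cat.
  by apply: (subgroupM subK) => //; exact: subgroupV.
by move/(congr1 (@fgword n)); rewrite ev_reduced //; case: (s1).
Qed.

(** Positions of [g] map injectively to at most [2 * N] darts: excising between two equal darts
    would contradict [size_gen1_ge]. *)
Lemma size_generator_le (n : nat) (g : freeGroup n) (N : nat)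
    (f : edge (core_star (gen_by [set g]%classic)) -> 'I_N) :
  0 < N -> injective f -> size g <= 2 * N.
Proof.
case: N f => // N f _ injf; set K := gen_by _ in f injf.
have subK : is_subgroup K := is_subgroup_gen_by _.
have Kg : K g by move=> B [_]; apply.
have [g1|g1] := pselect (g = 1%g); first by rewrite g1.
have [code codeP] := dart_code subK ord0 injf.
have z0 : 'I_n * bool.
  by case Eg : (fgword g) => [|z r]; [case: g1; apply: val_inj|exact: z].
pose F c := code (take c g) (nth z0 g c).
have main i j : i < j < size g -> F i <> F j.
  move=> ij; have [s1 [s2 [s3 [Eg ts1 ts2 _ _]]]] := seq_split2 z0 ij.
  move: Eg; rewrite /F ts1 ts2; set l := nth _ _ i; set l' := nth _ _ j => Eg.
  move=> /(@codeP s1 l (s2 ++ l' :: s3) (s1 ++ l :: s2) l' s3) [||||El Ks].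
  1,2,3,4: by rewrite -?catA /= -Eg ?ev_fgword //; apply: valP.
  move: Eg; rewrite -El => Eg; have [Kh h1 Eh] := excise subK Kg Eg Ks.
  have := size_gen1_ge g1 Kh h1.
  by rewrite Eh Eg !size_cat /= size_cat /=; lia.
have uF : uniq (map F (iota 0 (size g))).
  rewrite map_inj_in_uniq ?iota_uniq // => i j.
  rewrite !mem_iota !add0n /= => si sj; case: (ltngtP i j) => // ij Fij.
    by case: (main i j); rewrite ?ij.
  by case: (main j i); rewrite ?ij.
rewrite -{1}(size_iota 0 (size g)) -(size_map F) -(card_uniqP uF).
by apply: leq_trans (max_card _) _; rewrite card_prod card_ord card_bool mulnC.
Qed.

(** * Equations up to their pattern of coefficients and signs *)

Section Compat.
Variable A : groupType.
Implicit Types w : seq (A + bool).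

(** Forgets the values of coefficients. Cyclic reducedness and the number of x-letters depend on
    this pattern alone, and so does reducedness once all coefficients are non-trivial. *)
Definition kind (l : A + bool) : option bool :=
  if l is inr b then Some b else None.

Definition kind_compat (k k' : option bool) : bool :=
  match k, k' with
  | None, None => false
  | Some b, Some c => b == c
  | _, _ => true
  end.

Lemma eq_compatE : @eq_compat A =2 relpre kind kind_compat.
Proof. by case=> [h|b] [k|c]. Qed.

Lemma kind_reduced w w' : map kind w = map kind w' ->
  all (@Defs.eq_proper A) w' -> eq_reduced w -> eq_reduced w'.
Proof.
move=> E pw' /andP[_]; rewrite /eq_reduced pw' /=.
rewrite !(eq_sorted eq_compatE).
by rewrite -!sorted_map E.
Qed.

Lemma kind_cyclically_reduced w w' : map kind w = map kind w' ->
  cyclically_reduced w -> cyclically_reduced w'.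
Proof.
move=> E; rewrite /cyclically_reduced !(eq_cycle eq_compatE) -!cycle_map E.
by rewrite -(size_map kind w) -(size_map kind w') E.
Qed.

Lemma kind_count w w' : map kind w = map kind w' ->
  count (@is_x A) w = count (@is_x A) w'.
Proof.
have E : @is_x A =1 preim kind isSome by case.
by move=> Ew; rewrite !(eq_count E) -!count_map Ew.
Qed.

(** Around the cycle no two coefficients are adjacent, so they do not outnumber the x-letters. The
    positive count excludes a lone coefficient. *)
Lemma size_cyclically_reduced w : cyclically_reduced w -> 0 < count (@is_x A) w ->
  size w <= 2 * count (@is_x A) w.
Proof.
case/orP=> [|cw] w0; first by lia.
rewrite -(count_predC (@is_x A) w) mul2n -addnn leq_add2l.
case: w cw {w0} => // l w; rewrite /cycle => pw.
(* The two boundary terms cancel when the path closes up. *)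
have H (l' : A + bool) s : path (@eq_compat A) l' s ->
    count (predC (@is_x A)) s + ~~ is_x l' <=
    count (@is_x A) s + ~~ is_x (last l' s).
  elim: s l' => //= m s IHs l' /andP[lm /IHs].
  by move: lm; case: l' m => [h|b] [k|c] //= _; lia.
have := H _ _ pw; rewrite last_rcons -cats1 !count_cat /=.
by case: (is_x l) => /=; lia.
Qed.

Lemma cyclic_reduction_id w : cyclically_reduced w -> cyclic_reduction w = w.
Proof.
rewrite /cyclic_reduction => cw; elim: (size w) => //= k ->.
by rewrite /cyclic_step cw.
Qed.

Lemma cyclic_reduction_coeffs (H : set A) w : is_subgroup H ->
  (forall h, inl h \in w -> H h) -> forall h, inl h \in cyclic_reduction w -> H h.
Proof.
move=> subH Hw; rewrite /cyclic_reduction; elim: (size w) => //= k.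
move: (iter k _ _) => {Hw}w Hw h; rewrite /cyclic_step.
case: ifP => [_|_]; first exact: Hw.
case: w Hw => // l w Hw.
have Hlast h' : inl h' = last l w -> H h' by move=> E; apply: Hw; rewrite E mem_last.
have Hbel h' : inl h' \in belast l w -> H h' by move=> /mem_belast /Hw.
move: (last l w) (belast l w) Hlast Hbel => m s Hm Hs.
have Hs' a s' : s = a :: s' -> inl h \in s' -> H h.
  by move=> E hs'; apply: Hs; rewrite E inE hs' orbT.
case: m Hm => [k'|b] Hm; case: s Hs Hs' => [|[k''|c] s'] Hs Hs' /=.
- by case: ifP => //; rewrite inE => _ /eqP[->]; apply: Hm.
- case: ifP => _; first exact: (Hs' _ _ erefl).
  rewrite inE => /orP[/eqP[->]|]; last exact: (Hs' _ _ erefl).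
  apply: subgroupM => //; first exact: Hm.
  by apply: Hs; rewrite mem_head.
- case: ifP => _; first exact: Hs.
  by rewrite inE => /orP[/eqP[->]|]; [apply: Hm|apply: Hs].
- by rewrite inE.
- by rewrite inE /= => /Hs.
- by case: ifP => _; [rewrite inE /= => /Hs|apply: (Hs' _ _ erefl)].
Qed.

End Compat.

(** * Admissible words and the minimality argument *)

Section Pumping.
Variables (n : nat) (H : set (freeGroup n)) (g : freeGroup n) (d : nat).
Hypotheses (subH : is_subgroup H) (d0 : 0 < d).
Local Notation A := (freeGroup n).
Local Notation L := ('I_n * bool)%type.
Implicit Types w : seq (A + bool).

Definition value w : A := (\prod_(l <- w) letter_value g l)%g.

Definition admissible w : Prop := [/\ eq_reduced w, cyclically_reduced w,
  forall h, inl h \in w -> H h, value w = 1%g & count (@is_x A) w = d].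

Definition spell (l : A + bool) : seq L := fgword (letter_value g l).

Definition len w := size (flatten (map spell w)).

Lemma value_cat w w' : value (w ++ w') = (value w * value w')%g.
Proof. by rewrite /value big_cat. Qed.

Lemma value_cons l w : value (l :: w) = (letter_value g l * value w)%g.
Proof. by rewrite /value big_cons. Qed.

Lemma ev_spell w : ev (flatten (map spell w)) = value w.
Proof.
elim: w => [|l w IHw] /=; first by rewrite ev_nil /value big_nil.
by rewrite ev_cat IHw value_cons ev_fgword.
Qed.

(** The cyclic reduction is a conjugate of [w], so its value is still trivial. *)
Lemma admissible_of_ideal (w : equation A) : ideal H g w -> degree w = d ->
  exists w', admissible w'.
Proof.
move=> [Hw pw] dw; have [u [v [Ev cv Ew]]] := cyclic_reductionP w.
exists v; split=> //; first exact: valP.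
- by move=> h; rewrite Ev => /cyclic_reduction_coeffs; apply=> // k /Hw.
- have Vu : (phi g u^-1 = (phi g u)^-1)%g.
    by apply: (mulgI (phi g u)); rewrite -phiM !mulgV /phi big_nil.
  apply: (mulgI (phi g u)); apply: (mulIg (phi g u)^-1%g).
  by rewrite mulg1 mulgV -pw Ew !phiM Vu.
- by rewrite Ev.
Qed.

Lemma ideal_of_admissible (w : equation A) : admissible w ->
  ideal H g w /\ degree w = d.
Proof.
case=> _ cw Hw vw dw; split; first by [].
by rewrite /degree cyclic_reduction_id.
Qed.

Lemma admissible_replace w1 h w2 k w3 h' k' :
  admissible (w1 ++ inl h :: w2 ++ inl k :: w3) ->
  H h' -> H k' -> h' <> 1%g -> k' <> 1%g ->
  (h' * value w2 * k' * value w3 = h * value w2 * k * value w3)%g ->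
  admissible (w1 ++ inl h' :: w2 ++ inl k' :: w3).
Proof.
set w := (X in admissible X -> _); set w' := (X in _ -> admissible X).
move=> [rw cw Hw vw dw] Hh' Hk' /eqP h1 /eqP k1 E.
have Ek : map (@kind A) w = map (@kind A) w' by rewrite !(map_cat, map_cons).
split.
- apply: kind_reduced Ek _ (rw); case/andP: rw; rewrite /w /w'.
  by rewrite !all_cat /= !all_cat /= h1 k1 => /and5P[-> _ -> _ ->].
- exact: kind_cyclically_reduced cw.
- move=> h0; rewrite /w' !(mem_cat, inE) => /or4P[i|/eqP[->] //|i|].
  + by apply: Hw; rewrite /w !(mem_cat, inE) i.
  + by apply: Hw; rewrite /w !(mem_cat, inE) i !orbT.
  + case/orP=> [/eqP[->] //|i].
    by apply: Hw; rewrite /w !(mem_cat, inE) i !orbT.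
- rewrite -vw /w /w' !(value_cat, value_cons) /=; congr (_ * _)%g.
  by move: E; rewrite !mulgA.
- by rewrite -(kind_count Ek).
Qed.

Lemma count_x_letters w :
  count id (flatten [seq nseq (size (spell l)) (is_x l) | l <- w]) =
  count (@is_x A) w * size g.
Proof.
elim: w => //= l w IHw; rewrite count_cat IHw count_nseq mulnDl.
by case: l => [h|[]] //=; rewrite ?mul1n // /fg_invw size_rev size_map.
Qed.

(** The last two hypotheses come from nested pairs: the outer one joins the first [l] to the second
    [m], the inner one the second [l] to the first [m]. After the cut, the stretch from [l] to [m]
    is that of the inner pair, hence trivial; the outer equation shows that the value is
    unchanged. *)
Lemma admissible_cut w1 h w2 k w3 s1 l s2 s3 t1 m t2 t3 :
  admissible (w1 ++ inl h :: w2 ++ inl k :: w3) ->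
  fgword h = s1 ++ l :: s2 ++ l :: s3 -> fgword k = t1 ++ m :: t2 ++ m :: t3 ->
  H (ev (s1 ++ l :: s2) * (ev s1)^-1)%g -> H (ev (t1 ++ m :: t2) * (ev t1)^-1)%g ->
  (ev (l :: s2 ++ l :: s3) * value w2 * k * value w3 = ev t3 * value w3)%g ->
  (ev (l :: s3) * value w2 * k * value w3 = ev (t2 ++ m :: t3) * value w3)%g ->
  exists2 w', admissible w' & len w' < len (w1 ++ inl h :: w2 ++ inl k :: w3).
Proof.
move=> aw Eh Ek Hs Ht E1 E2.
have Hh : H h by case: aw => _ _ + _ _; apply; rewrite !(mem_cat, inE) eqxx !orbT.
have Hk : H k by case: aw => _ _ + _ _; apply; rewrite !(mem_cat, inE) eqxx !orbT.
have [Hh' h1 Eh'] := excise subH Hh Eh Hs.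
have [Hk' k1 Ek'] := excise subH Hk Ek Ht.
exists (w1 ++ inl (ev (s1 ++ l :: s3)) :: w2 ++ inl (ev (t1 ++ m :: t3)) :: w3).
  apply: admissible_replace (aw) _ _ _ _ _ => //.
  have kE : k = (ev t1 * letter m * ev (t2 ++ m :: t3))%g.
    by rewrite -[LHS]ev_fgword Ek ev_cat ev_cons mulgA.
  have y1 : (ev (l :: s3) * value w2 * ev t1 * letter m = 1)%g.
    apply: (mulIg (ev (t2 ++ m :: t3) * value w3)%g); rewrite mul1g -[RHS]E2.
    by rewrite kE !mulgA.
  have -> : (h * value w2 * k * value w3 =
      ev s1 * (ev (l :: s2 ++ l :: s3) * value w2 * k * value w3))%g.
    by rewrite -{1}(ev_fgword h) Eh ev_cat !mulgA.
  rewrite E1 (ev_cat s1) (ev_cat t1) (ev_cons m t3).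
  transitivity (ev s1 * (ev (l :: s3) * value w2 * ev t1 * letter m) *
    (ev t3 * value w3))%g; first by rewrite !mulgA.
  by rewrite y1 mulg1.
rewrite /len !(map_cat, map_cons, flatten_cat) /= !(map_cat, map_cons, flatten_cat) /=.
rewrite /spell /= Eh' Ek' Eh Ek !(size_cat, size_flatten) /= !size_cat /=; lia.
Qed.

(** [T] names the darts of the core. The first summand counts the positions in pairs joining
    coefficients, the second those in pairs meeting an x-letter. *)
Lemma minimal_len_bound (T : finType) (code : seq L -> L -> T) w :
  (forall s1 l s2 t1 m t2,
    fg_reduced (s1 ++ l :: s2) -> H (ev (s1 ++ l :: s2)) ->
    fg_reduced (t1 ++ m :: t2) -> H (ev (t1 ++ m :: t2)) ->
    code s1 l = code t1 m -> l = m /\ H (ev t1 * (ev s1)^-1)%g) ->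
  admissible w -> (forall w', admissible w' -> len w <= len w') ->
  len w <= 2 * (4 * d ^ 2 * #|T| ^ 2) + 4 * (d * size g).
Proof.
move=> codeP aw minw; have [rw cw Hw vw dw] := aw.
have sw : size w <= 2 * d by rewrite -dw size_cyclically_reduced ?dw.
set ss := map spell w; set E := flatten ss.
have [E0|[z0 _]] : E = [::] \/ exists z0, z0 \in E.
- by case: (E) => [|z r]; [left|right; exists z; rewrite mem_head].
- by rewrite /len -/ss -/E E0.
have evE : ev E = 1%g by rewrite ev_spell.
have [P [m [sE mP mN]]] := noncrossing_matching evE.
(* Position [j] of [E] is spelled by letter number [blk j] of [w], at place [off j] of its
   spelling. *)
pose blk := reshape_index (shape ss); pose off := reshape_offset (shape ss).
pose x0 : A + bool := inr true.
pose isX j := is_x (nth x0 w (blk j)).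
have blkP j : j < size E -> blk j < size w.
  by rewrite size_flatten => /reshape_indexP; rewrite !size_map.
have ssE r : r < size w -> nth [::] ss r = spell (nth x0 w r).
  by move=> rw'; rewrite (nth_map x0).
have offP j : j < size E -> off j < size (spell (nth x0 w (blk j))).
  move=> sj; rewrite -ssE ?blkP //; move: sj; rewrite size_flatten => sj.
  have := reshape_offsetP sj; rewrite (nth_map [::]) // size_map; apply: blkP.
  by rewrite size_flatten.
have nX : count isX (iota 0 (size E)) = d * size g.
  rewrite -dw -count_x_letters; set F := flatten _.
  have shF : shape [seq nseq (size (spell l)) (is_x l) | l <- w] = shape ss.
    by rewrite /shape -!map_comp; apply: eq_map => l /=; rewrite size_nseq.
  have sF : size F = size E by rewrite /F /E !size_flatten shF.
  rewrite -[in RHS](mkseq_nth false F) /mkseq count_map sF.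
  apply: eq_in_count => j; rewrite mem_iota add0n /= => sj.
  rewrite /F nth_flatten shF -/(blk j) (nth_map x0) ?blkP //.
  by rewrite nth_nseq offP.
(* Distinct pairs have distinct left ends, so at most [d * size g] of these are in x-letters. *)
have mXX : count [predI P & preim m isX] (iota 0 (size E)) <= d * size g.
  rewrite -nX -!size_filter -(size_map m); apply: uniq_leq_size.
    rewrite map_inj_in_uniq ?filter_uniq ?iota_uniq // => j k.
    rewrite !mem_filter /= => /andP[/andP[Pj _] _] /andP[/andP[Pk _] _] mjk.
    case: (ltngtP k j) => [kj|jk|->] //.
      by have [/(_ mjk)] := mN j k Pj Pk kj.
    by have [/(_ (esym mjk))] := mN k j Pk Pj jk.
  move=> i /mapP[j]; rewrite mem_filter => /andP[/andP[Pj Xj] _] ->.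
  have {}Xj : isX (m j) := Xj; rewrite mem_filter Xj mem_iota /= add0n.
  by have [/andP[mj sj] _ _] := mP z0 j Pj; rewrite (ltn_trans mj).
pose tok j := nth z0 E j.
pose pre j := take (off j) (spell (nth x0 w (blk j))).
(* The letters of [w] are indexed by ['I_N.+1] with [N.+1 = 2 * d], the successor form that [inord]
   needs. *)
case Ed : (2 * d) => [|N]; first by lia.
pose key j : 'I_N.+1 * 'I_N.+1 * (T * T) :=
  (inord (blk j), inord (blk (m j)),
    (code (pre j) (tok j), code (pre (m j)) (tok (m j)))).
pose S := [seq j <- iota 0 (size E) | [&& P j, ~~ isX j & ~~ isX (m j)]].
have sS : size S <= 4 * d ^ 2 * #|T| ^ 2.
  rewrite -(size_map key); have uS : uniq (map key S); last first.
    rewrite -(card_uniqP uS); apply: leq_trans (max_card _) _.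
    by rewrite !card_prod !card_ord -Ed; lia.
  have E_leq i j : (i <= j) = (blk i < blk j) || (blk i == blk j) && (off i <= off j).
    exact: reshape_leq.
  have dropE i c : i < size E -> c <= 1 -> ev (drop (c + i) E) =
      (ev (drop (c + off i) (spell (nth x0 w (blk i)))) *
        value (drop (blk i).+1 w))%g.
    by move=> si c1; rewrite drop_flatten // -/(off i) -/(blk i) ssE ?blkP //
      ev_cat -map_drop ev_spell.
  have tokE i : i < size E -> tok i = nth z0 (spell (nth x0 w (blk i))) (off i).
    by move=> si; rewrite /tok nth_flatten -/(off i) -/(blk i) ssE ?blkP.
  (* Each spelling is reduced, so its suffixes of different lengths have different values; hence no
     pair lies within a single letter. *)
  have mblk j : P j -> blk (m j) < blk j.
    move=> Pj; have [/andP[mj sj] _ Em] := mP z0 j Pj.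
    have smj := ltn_trans mj sj; have := ltnW mj; rewrite E_leq.
    case/orP=> // /andP[/eqP eb le_off].
    move: Em; rewrite (dropE _ 0 smj) // (dropE _ 1 sj) // eb => /mulIg.
    have rs := valP (letter_value g (nth x0 w (blk j))).
    have rd c : fg_reduced (drop c (spell (nth x0 w (blk j)))).
      by have := rs; rewrite -[X in fg_reduced X](cat_take_drop c) => /reduced_cat/andP[].
    move=> /(ev_inj (rd _) (rd _)) /(congr1 size); rewrite !size_drop.
    by have := offP j sj; lia.
  have blk_inj i j : i < size E -> j < size E ->
      inord (blk i) = inord (blk j) :> 'I_N.+1 -> blk i = blk j.
    move=> /blkP bi /blkP bj /(congr1 val); rewrite /= !inordK //; lia.
  have main j k : j \in S -> k \in S -> key j = key k -> k < j -> False.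
    rewrite !mem_filter => /andP[/and3P[Pj Xj Xmj] _] /andP[/and3P[Pk Xk Xmk] _].
    have [/andP[mj sj] _ Ej] := mP z0 j Pj; have smj := ltn_trans mj sj.
    have [/andP[mk sk] _ Ek] := mP z0 k Pk; have smk := ltn_trans mk sk.
    case=> /(blk_inj _ _ sj sk) bq /(blk_inj _ _ smj smk) bp cq cp kj.
    have pq : blk (m j) < blk j := mblk j Pj.
    have offkj : off k < off j by move: kj; rewrite ltnNge E_leq bq eqxx ltnn -ltnNge.
    (* The block of [m j] precedes the common block of [j] and [k]; noncrossing then nests the pair
       of [k] inside that of [j]. *)
    have mjk : m j < k by rewrite ltnNge E_leq -bq; lia.
    have [_ /(_ mjk) mjmk] := mN j k Pj Pk kj.
    have offm : off (m j) < off (m k).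
      by move: mjmk; rewrite ltnNge E_leq bp eqxx ltnn -ltnNge.
    have {}pq : blk (m j) < blk j < size w by rewrite pq blkP.
    have [w1 [w2 [w3 [Ew _ _ dp dq]]]] := seq_split2 x0 pq.
    have coeff i : ~~ isX i -> exists h, nth x0 w (blk i) = inl h.
      by rewrite /isX; case: (nth _ _ _) => // h _; exists h.
    have [h Eh] := coeff _ Xmj; have [u Eu] := coeff _ Xj.
    have Hh : H h by apply: Hw; rewrite -Eh mem_nth // blkP.
    have Hu : H u by apply: Hw; rewrite -Eu mem_nth // blkP.
    have s12 : off (m j) < off (m k) < size (fgword h).
      by rewrite offm; have := offP _ smk; rewrite -bp Eh.
    have t12 : off k < off j < size (fgword u).
      by rewrite offkj; have := offP _ sj; rewrite Eu.
    have [s1 [s2 [s3 [Es ts1 ts2 ds1 ds2]]]] := seq_split2 z0 s12.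
    have [t1 [t2 [t3 [Et tt1 tt2 dt1 dt2]]]] := seq_split2 z0 t12.
    move: cp cq Ej Ek; rewrite /pre !tokE // -bp -bq Eh Eu /spell /= ts1 ts2 tt1 tt2.
    rewrite (dropE _ 0 smj) // (dropE _ 0 smk) // (dropE _ 1 sj) // (dropE _ 1 sk) //.
    rewrite -bp -bq Eh Eu /spell /= dp dq dt1 dt2.
    rewrite (drop_nth z0 (ltn_trans offm (proj2 (andP s12)))) ds1.
    rewrite (drop_nth z0 (proj2 (andP s12))) ds2.
    move: Es Et; set l := nth z0 _ _; set l' := nth z0 _ _.
    set e := nth z0 _ _; set e' := nth z0 _ _ => Es Et.
    have rh := valP h; have ru := valP u; rewrite /= in rh ru.
    move=> /(@codeP s1 l (s2 ++ l' :: s3) (s1 ++ l :: s2) l' s3) [||||El Hs].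
    1,2,3,4: by rewrite -?catA /= -Es ?ev_fgword.
    move=> /esym /(@codeP t1 e (t2 ++ e' :: t3) (t1 ++ e :: t2) e' t3) [||||Ee Ht].
    1,2,3,4: by rewrite -?catA /= -Et ?ev_fgword.
    move: Es Et Hs Ht; rewrite -El -Ee => Es Et Hs Ht.
    rewrite !(value_cat, value_cons) Eu /= !mulgA => E1 E2.
    have [|w' aw'] := admissible_cut (w1 := w1) _ Es Et Hs Ht E1 E2.
      by rewrite -Eh -Eu -Ew.
    by rewrite ltnNge -Eh -Eu -Ew minw.
  have kinj : {in S &, injective key}.
    move=> a b aS bS Eab; case: (ltngtP b a) => [ba|ab|->] //.
      by case: (main a b).
    by case: (main b a).
  by rewrite (map_inj_in_uniq kinj) filter_uniq ?iota_uniq.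
(* A pair joins two coefficients, or its right end or its left end is in an x-letter. *)
have : count P (iota 0 (size E)) <= size S + d * size g + d * size g.
  have countU a b (s : seq nat) : count (predU a b) s <= count a s + count b s.
    by rewrite -count_predUI leq_addr.
  apply: leq_trans (leq_add (leq_add (leqnn _) (eq_leq nX)) mXX).
  rewrite size_filter; apply: leq_trans (leq_add (countU _ _ _) (leqnn _)).
  apply: leq_trans (countU _ _ _); apply: sub_count => j /= Pj.
  by rewrite !unfold_in /= Pj; case: (isX j); case: (isX (m j)).
move=> /(leq_mul (leqnn 2)) cP.
have -> : len w = 2 * count P (iota 0 (size E)) by rewrite mul2n.
apply: leq_trans cP _.
by move: (d * size g) (4 * _ * _) (size S) sS => x M y; lia.
Qed.

Lemma word_loop_exists w : (forall h, inl h \in w -> H h) ->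
  exists q : seq (dart (eq_graph H g)), [/\ word_loop w q, is_loop q & size q = len w].
Proof.
elim: w => [|l w IHw] Hw; first by exists [::].
have [|q [wq lq sq]] := IHw; first by move=> h hw; apply: Hw; rewrite inE hw orbT.
have [p [lp pl sp]] : exists p : seq (dart (eq_graph H g)),
    [/\ letter_loop l p, is_loop p & size p = size (spell l)].
  case: l Hw => [h|b] Hw.
    have [|p [lp pl sp]] := loop_of_subgroup subH (h := h).
      by apply: Hw; rewrite mem_head.
    exists (path_inl _ p); split; [by exists p|exact: is_loop_inl|].
    by rewrite size_map.
  have subK : is_subgroup (gen_by [set g]%classic) := is_subgroup_gen_by _.
  have Kg : gen_by [set g]%classic g by move=> B [_]; apply.
  have [|p [lp pl sp]] := loop_of_subgroup subK (h := sgnpow b g).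
    by case: b {Hw} => //=; apply: (subgroupV subK).
  exists (path_inr _ p); split; [by exists p|exact: is_loop_inr|].
  by rewrite size_map.
exists (p ++ q); split; [by exists p, q|exact: is_loop_cat|].
by rewrite /len /= !size_cat sp sq.
Qed.

End Pumping.

(** * From the minimal equation to the bound *)

Lemma num_edges_inj (X : pgraph) : finite_set [set: edge X] ->
  exists f : edge X -> 'I_(num_edges X), injective f.
Proof.
move=> /finite_setP[N XN]; rewrite (num_edges_eq XN).
have /card_set_bijP[f [fN finj _]] := XN.
have fN' e : f e < N by apply: (fN e).
exists (fun e => Ordinal (fN' e)) => e1 e2 /(congr1 val) /= E12.
by apply: finj; rewrite ?in_setE.
Qed.

Theorem theorem5p10 (n : nat) (H : set (freeGroup n)) (g : freeGroup n)
    (d : nat) :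
  is_subgroup H -> finitely_generated H ->
  g <> 1%g -> depends_on g H -> (1 <= d)%N ->
  (exists w : equation (freeGroup n),
    [/\ ideal H g w, w <> 1%g & degree w = d]) ->
  let L := num_edges (eq_graph H g) in
  exists (w : equation (freeGroup n)) (sigma : seq (dart (eq_graph H g))),
    [/\ ideal H g w, w <> 1%g, degree w = d, equation_path w sigma &
        (size sigma <= 32 * L ^ 4 * d ^ 2 + 16 * L ^ 3 * d)%N].
Proof.
move=> subH fgH g1 _ d0 [w0 [Iw0 _ dw0]] L.
set K := gen_by [set g]%classic.
have subK : is_subgroup K := is_subgroup_gen_by _.
have Kg : K g by move=> B [_]; apply.
have fgK : finitely_generated K.
  by exists [:: g]; congr gen_by; apply/seteqP; split=> x /=; rewrite inE => /eqP.
have [|f injf] := @num_edges_inj (eq_graph H g).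
  rewrite (_ : [set: _] = [set inl e | e in [set: edge (core_star H)]] `|`
    [set inr e | e in [set: edge (core_star K)]])%classic.
    by rewrite finite_setU; split; apply: finite_image; apply: finite_core.
  by apply/seteqP; split=> // -[e|e] _; [left|right]; exists e.
(* The loop of the non-trivial [g] has at least one edge. Positivity provides the default dart code
   and allows powers of [L] to be raised at the end. *)
have L0 : 0 < L.
  have [p [_ _]] := loop_of_subgroup subK Kg.
  case: p => [|[e b] p _]; last by case: (f (inr e)) => i; apply: leq_trans.
  by move/esym/size0nil => E; case: g1; apply: val_inj.
have sg : size g <= 2 * L.
  by apply: (@size_generator_le n g L (fun e => f (inr e))) => // e1 e2 /injf[].
have injfl : injective (fun e : edge (core_star H) => f (inl e)).
  by move=> e1 e2 /injf[].
have [code codeP] := dart_code subH (Ordinal L0) injfl.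
have [w1 aw1] := admissible_of_ideal subH Iw0 dw0.
have exP : exists k, `[< exists2 w, admissible H g d w & len g w = k >].
  by exists (len g w1); apply/asboolP; exists w1.
have [k /asboolP[w aw lw] mink] := ex_minnP exP.
have minw w' : admissible H g d w' -> len g w <= len g w'.
  by move=> aw'; rewrite lw; apply: mink; apply/asboolP; exists w'.
have := minimal_len_bound subH d0 codeP aw minw.
rewrite card_prod card_ord card_bool => bw.
have [rw _ Hw _ cw] := aw; pose e : equation _ := Equation rw.
have [Ie de] : ideal H g e /\ degree e = d by exact: ideal_of_admissible.
have [q [wq lq sq]] := word_loop_exists g subH Hw.
(* Removing backtracks does not lengthen the loop, so [len] also bounds the reduced path. *)
have [sigma [hq rq sle]] := reduce_loop lq.
exists e, sigma; split=> //.
- by move=> e1; move: d0; rewrite -de e1.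
- by split=> //; exists q.
apply: leq_trans sle _; rewrite sq; apply: leq_trans bw _.
(* With [2 * L] darts and [size g <= 2 * L] the bound reads [32 * L ^ 2 * d ^ 2 + 8 * L * d], which
   is at most the required one. *)
have L24 : L ^ 2 <= L ^ 4 by rewrite leq_pexp2l.
have L13 : L <= L ^ 3 by rewrite -{1}(expn1 L) leq_pexp2l.
have H1 := leq_mul (leqnn (32 * d ^ 2)) L24.
have H2 := leq_mul (leqnn (8 * d)) L13.
have H3 := leq_mul (leqnn (4 * d)) sg.
rewrite expnMn -/L; move: H1 H2 H3; lia.
Qed.
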